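(* Let $\Lambda\in\mathcal{L}$ and $w,\hat w\in W$, and let $A^\pm_{w,\hat w}:\mathbb{F}[\Lambda]\to\mathbb{F}[\Lambda]$ be the $\mathbb{F}$-linear operators $A^\pm_{w,\hat w}(f)=\gamma_w(\mathbf{1}^\pm fT_{\hat w})$. Then, as operators on $\mathbb{F}[\Lambda]$, \begin{align*} A^+_{w,\hat w}&=t(w_0)\,w_0\,\pi\big(T_{(w_0w)^{-1}}^{-1}T_{\hat w^{-1}}\big),\\ A^-_{w,\hat w}&=t(w_0)^{-1}(-1)^{l(w)+l(\hat w)}\,\iota w_0\,\pi\big(T_{w_0w}T_{\hat w}^{-1}\big)\iota . \end{align*}
   Context: Let $E$ be a Euclidean space with dual $E^*$ and $\Phi\subset E^*$ a reduced irreducible root system (in its span). For $\alpha\in\Phi$, $\alpha^\vee\in E$ is the vector with $\langle y,\alpha^\vee\rangle=2\alpha(y)/\|\alpha\|^2$ for all $y\in E$. Fix simple roots $\alpha_1,\dots,\alpha_r$; $W$ is the finite Weyl group, with simple reflections $s_i$, acting on $E$ by $s_\alpha(y)=y-\alpha(y)\alpha^\vee$; $l$ is the length, $w_0$ the longest element. $Q^\vee$ is the coroot lattice. $\mathcal{L}$ is the set of finitely generated abelian subgroups $\Lambda\subset E$ with $Q^\vee\subseteq\Lambda$ and $\alpha(\Lambda)\subseteq\mathbb{Z}$ for all $\alpha\in\Phi$. $\mathbb{F}$ is a field; $\mathbb{F}[\Lambda]$ is the group algebra with basis $x^\lambda$; $W$ acts by $wx^\lambda=x^{w\lambda}$; $\iota$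 is the linear map $x^\lambda\mapsto x^{-\lambda}$. Fix a $W$-invariant map $\Phi\to\mathbb{F}^\times$, $\alpha\mapsto t_\alpha$; $t_j=t_{\alpha_j}$, and $t(w)=t_{j_1}\cdots t_{j_k}$ for a reduced expression $w=s_{j_1}\cdots s_{j_k}$. For $f\in\mathbb{F}[\Lambda]$, $\nabla_j(f)=\frac{s_jf-f}{x^{\alpha_j^\vee}-1}$. The extended affine Hecke algebra $\widetilde{\mathcal{H}}_\Lambda$ is generated by $T_1,\dots,T_r$ and $x^\lambda$ ($\lambda\in\Lambda$) with: braid relations; $(T_j-t_j)(T_j+t_j^{-1})=0$; $x^\lambda x^\mu=x^{\lambda+\mu}$, $x^0=1$; $T_jx^\lambda-x^{s_j\lambda}T_j=(t_j-t_j^{-1})\nabla_j(x^\lambda)$. $T_w=T_{j_1}\cdots T_{j_k}$ for a reduced expression. $\widetilde{\mathcal{H}}_\Lambda$ is a free left $\mathbb{F}[\Lambda]$-module with basis $T_w$, $w\in W$; $\gamma_w:\widetilde{\mathcal{H}}_\Lambda\to\mathbb{F}[\Lambda]$ is defined by $h=\sum_{w\in W}\gamma_w(h)T_w$. $\mathbf{1}^+=\sum_{w\in W}t(w)T_w$, $\mathbf{1}^-=\sum_{w\in W}(-1)^{l(w)}t(w)^{-1}T_w$. The polynomial representation $\pi$ of $\widetilde{\mathcal{H}}_\Lambda$ on $\mathbb{F}[\Lambda]$: $\pi(T_j)f=t_js_jf+(t_j-t_j^{-1})\nabla_j(f)$, and $\pi(x^\mu)$ is multiplication by $x^\mu$.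 *)

(* Defs.v *)
From HB Require Import structures.
From mathcomp Require Import all_boot all_order all_algebra.
From mathcomp Require Import finmap.
From mathcomp Require Import boolp classical_sets fsbigop reals.
From mathcomp.multinomials Require Import monalg.

Set Implicit Arguments.
Unset Strict Implicit.
Unset Printing Implicit Defensive.

Import Order.TTheory GRing.Theory Num.Theory.

Local Open Scope ring_scope.
Local Open Scope quotient_scope.

Section LinearExtension.
Variables (F : fieldType) (K : choiceType) (V : lmodType F).
Implicit Types (f g : {malg F[K]}) (phi : K -> V).

Definition linext phi f : V := \sum_(k <- msupp f) f@_k *: phi k.

Lemma linextEw phi f (d : {fset K}) :
  (msupp f `<=` d)%fset -> linext phi f = \sum_(k <- d) f@_k *: phi k.
Proof.
move=> sfd; rewrite /linext.
apply: big_fset_incl => // k _ kf.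
by rewrite mcoeff_outdom // scale0r.
Qed.

Lemma linext_is_linear phi : linear (linext phi).
Proof.
move=> c f g.
pose d := (msupp f `|` msupp g `|` msupp (c *: f + g))%fset.
have sf : (msupp f `<=` d)%fset by rewrite /d -fsetUA fsubsetUl.
have sg : (msupp g `<=` d)%fset by rewrite /d fsetUAC fsubsetUr.
have sh : (msupp (c *: f + g) `<=` d)%fset by rewrite /d fsubsetUr.
rewrite (linextEw phi sf) (linextEw phi sg) (linextEw phi sh).
rewrite scaler_sumr -big_split /=; apply: eq_bigr => k _.
by rewrite mcoeffD mcoeffZ scalerDl scalerA.
Qed.

HB.instance Definition _ phi :=
  GRing.isLinear.Build F {malg F[K]} V *:%R (linext phi) (linext_is_linear phi).

Lemma linextU phi k : linext phi << k >> = phi k.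
Proof.
rewrite /linext msuppU oner_eq0 big_seq_fset1.
by rewrite mcoeffUU scale1r.
Qed.

End LinearExtension.

(* The group algebra F[G] of an additive abelian group G: finitely supported  *)
(* functions on G with the convolution product; << a >> is the basis element  *)
(* x^a.                                                                       *)

Definition galg (F : fieldType) (G : zmodType) := {malg F[G]}.

Section GroupAlgebra.
Variables (F : fieldType) (G : zmodType).
Local Notation A := (galg F G).

HB.instance Definition _ := GRing.Lmodule.on A.

Definition galg_mul (f g : A) : A :=
  linext (fun a => linext (fun b => << (a + b)%R >> : A) g) f.
Definition galg_one : A := << 0%R >>.

Lemma galg_ind (P : A -> Prop) :
  (forall c f g, P f -> P g -> P (c *: f + g)) -> P 0 ->
  (forall a, P << a >>) -> forall f, P f.
Proof.
move=> Plin P0 Px f; have /= -> : f = \sum_(k <- msupp f) f@_k *: << k >>.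
  rewrite [LHS]monalgE; apply: eq_bigr => k _; apply/malgP => k'.
  by rewrite mcoeffZ !mcoeffU mulr_natr.
elim/big_rec: _ => // k g _ Pg; exact: Plin.
Qed.

Lemma galg_mulDl c f1 f2 g :
  galg_mul (c *: f1 + f2) g = c *: galg_mul f1 g + galg_mul f2 g.
Proof. exact: linearP. Qed.

Lemma galg_mulDr f c g1 g2 :
  galg_mul f (c *: g1 + g2) = c *: galg_mul f g1 + galg_mul f g2.
Proof.
rewrite /galg_mul /linext scaler_sumr -big_split /=; apply: eq_bigr => k _.
by rewrite -/(linext _ (c *: g1 + g2)) linearP scalerDr !scalerA (mulrC c).
Qed.

Lemma galg_mul0r f : galg_mul f 0 = 0.
Proof. by have := galg_mulDr f (-1) 0 0; rewrite !scaleN1r oppr0 addr0 addNr. Qed.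

Lemma galg_mul0l g : galg_mul 0 g = 0.
Proof. by have := galg_mulDl (-1) 0 0 g; rewrite !scaleN1r oppr0 addr0 addNr. Qed.

Lemma galg_mulU a b : galg_mul << a >> << b >> = << (a + b)%R >>.
Proof. by rewrite /galg_mul !linextU. Qed.

Lemma galg_mul1 : left_id galg_one galg_mul.
Proof.
elim/galg_ind => [c f g fE gE||a]; first by rewrite galg_mulDr fE gE.
- by rewrite galg_mul0r.
by rewrite galg_mulU add0r.
Qed.

Lemma galg_mulC : commutative galg_mul.
Proof.
elim/galg_ind => [c f1 f2 f1E f2E||a] g.
- by rewrite galg_mulDl galg_mulDr f1E f2E.
- by rewrite galg_mul0r galg_mul0l.
elim/galg_ind: g => [c f g fE gE||b].
- by rewrite galg_mulDr galg_mulDl fE gE.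
- by rewrite galg_mul0r galg_mul0l.
by rewrite !galg_mulU addrC.
Qed.

Lemma galg_mulA : associative galg_mul.
Proof.
elim/galg_ind => [c f1 f2 f1E f2E||a] g h.
- by rewrite !galg_mulDl f1E f2E.
- by rewrite !galg_mul0l.
elim/galg_ind: g => [c f g fE gE||b].
- by rewrite galg_mulDl !galg_mulDr galg_mulDl fE gE.
- by rewrite galg_mul0l !galg_mul0r galg_mul0l.
elim/galg_ind: h => [c f g fE gE||d].
- by rewrite !galg_mulDr fE gE.
- by rewrite !galg_mul0r.
by rewrite !galg_mulU addrA.
Qed.

Lemma galg_mulDl1 : left_distributive galg_mul +%R.
Proof. by move=> f g h; have := galg_mulDl 1 f g h; rewrite !scale1r. Qed.

Lemma galg_one_neq0 : galg_one != 0.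
Proof. by rewrite monalgU_eq0 oner_neq0. Qed.

HB.instance Definition _ := GRing.Zmodule_isComNzRing.Build A
  galg_mulA galg_mulC galg_mul1 galg_mulDl1 galg_one_neq0.

Lemma galg_scaleAl c (f g : A) : c *: (f * g) = (c *: f) * g.
Proof.
have := galg_mulDl c f 0 g; rewrite addr0 galg_mul0l addr0 => fgE.
exact: esym fgE.
Qed.

HB.instance Definition _ := GRing.Lmodule_isLalgebra.Build F A galg_scaleAl.
HB.instance Definition _ := GRing.Lalgebra_isComAlgebra.Build F A.

End GroupAlgebra.

(* The F-algebra presented by generators in I and relations S (each element   *)
(* of S is set to zero): the free algebra modulo the two-sided ideal          *)
(* generated by S.                                                            *)

Definition freealg (F : fieldType) (I : choiceType) := {malg F[{fmonom I}]}.
HB.instance Definition _ F I := GRing.Lalgebra.on (freealg F I).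

Definition freegen (F : fieldType) (I : choiceType) (i : I) : freealg F I :=
  << fmu i >>.

Section PresentedAlgebra.
Variables (F : fieldType) (I : choiceType) (S : set (freealg F I)).
Local Notation A := (freealg F I).

Inductive in_ideal : A -> Prop :=
| ideal_gen x : S x -> in_ideal x
| ideal_zero : in_ideal 0
| ideal_sub x y : in_ideal x -> in_ideal y -> in_ideal (x - y)
| ideal_mull a x : in_ideal x -> in_ideal (a * x)
| ideal_mulr a x : in_ideal x -> in_ideal (x * a).

Definition ideal : {pred A} := fun x => `[< in_ideal x >].

Lemma idealP x : reflect (in_ideal x) (x \in ideal).
Proof. exact: asboolP. Qed.

Lemma ideal_zmod_closed : zmod_closed ideal.
Proof.
split; first by apply/idealP; exact: ideal_zero.
by move=> x y /idealP xI /idealP yI; apply/idealP; exact: ideal_sub.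
Qed.

HB.instance Definition _ := GRing.isZmodClosed.Build A ideal ideal_zmod_closed.

Definition presalg := Quotient.quot ideal.
HB.instance Definition _ := ZmodQuotient.on presalg.

Local Notation pr := (\pi_presalg : A -> presalg).

Lemma presalg_eqP (x y : A) : reflect (pr x = pr y) (x - y \in ideal).
Proof. by rewrite Quotient.idealrBE; exact: eqP. Qed.

Definition presalg_mul := lift_op2 presalg ( *%R : A -> A -> A).
Definition presalg_scale (c : F) := lift_op1 presalg ( *:%R c : A -> A).

Lemma pr_mul (x y : A) : presalg_mul (pr x) (pr y) = pr (x * y).
Proof.
unlock presalg_mul; apply/presalg_eqP; set x' := repr _; set y' := repr _.
have /presalg_eqP/idealP xx' : pr x' = pr x by rewrite reprK.
have /presalg_eqP/idealP yy' : pr y' = pr y by rewrite reprK.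
have -> : x' * y' - x * y = (x' - x) * y' - (- x) * (y' - y).
  by rewrite mulrBl mulNr opprK mulrBr addrA subrK.
by apply/idealP/ideal_sub; [exact: ideal_mulr | exact: ideal_mull].
Qed.

Lemma pr_scale c (x : A) : presalg_scale c (pr x) = pr (c *: x).
Proof.
unlock presalg_scale; apply/presalg_eqP; set x' := repr _.
have /presalg_eqP/idealP xx' : pr x' = pr x by rewrite reprK.
by rewrite -scalerBr -mulr_algl; apply/idealP/ideal_mull.
Qed.

Let prD (x y : A) : pr (x + y) = pr x + pr y.
Proof. exact: raddfD. Qed.

Lemma presalg_mulA : associative presalg_mul.
Proof.
elim/quotW=> x; elim/quotW=> y; elim/quotW=> z.
by rewrite !pr_mul mulrA.
Qed.

Lemma presalg_mul1l : left_id (pr 1) presalg_mul.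
Proof. by elim/quotW=> x; rewrite pr_mul mul1r. Qed.

Lemma presalg_mul1r : right_id (pr 1) presalg_mul.
Proof. by elim/quotW=> x; rewrite pr_mul mulr1. Qed.

Lemma presalg_mulDl : left_distributive presalg_mul +%R.
Proof.
elim/quotW=> x; elim/quotW=> y; elim/quotW=> z.
by rewrite -prD !pr_mul mulrDl prD.
Qed.

Lemma presalg_mulDr : right_distributive presalg_mul +%R.
Proof.
elim/quotW=> x; elim/quotW=> y; elim/quotW=> z.
by rewrite -prD !pr_mul mulrDr prD.
Qed.

Lemma presalg_mul_scalel c u v :
  presalg_scale c (presalg_mul u v) = presalg_mul (presalg_scale c u) v.
Proof.
elim/quotW: u => x; elim/quotW: v => y.
by rewrite pr_mul !pr_scale pr_mul scalerAl.
Qed.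

HB.instance Definition _ := GRing.Zmodule_isPzRing.Build presalg
  presalg_mulA presalg_mul1l presalg_mul1r presalg_mulDl presalg_mulDr.

Lemma presalg_scaleA a b u :
  presalg_scale a (presalg_scale b u) = presalg_scale (a * b) u.
Proof. by elim/quotW: u => x; rewrite !pr_scale scalerA. Qed.

Lemma presalg_scale1 : left_id 1 presalg_scale.
Proof. by elim/quotW=> x; rewrite pr_scale scale1r. Qed.

Lemma presalg_scaleDr : right_distributive presalg_scale +%R.
Proof.
by move=> c; elim/quotW=> x; elim/quotW=> y; rewrite -prD !pr_scale scalerDr prD.
Qed.

Lemma presalg_scaleDl u :
  {morph presalg_scale^~ u : a b / a + b >-> a + b}.
Proof. by move=> a b; elim/quotW: u => x; rewrite !pr_scale scalerDl prD. Qed.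

HB.instance Definition _ := GRing.Zmodule_isLmodule.Build F presalg
  presalg_scaleA presalg_scale1 presalg_scaleDr presalg_scaleDl.

Lemma presalg_scaleAl c (u v : presalg) : c *: (u * v) = (c *: u) * v.
Proof. exact: presalg_mul_scalel. Qed.

Definition presgen (i : I) : presalg := pr (freegen F i).

(* The two-sided inverse; a presented algebra may be trivial, so it is not a  *)
(* unitRingType.                                                              *)
Definition presinv (u : presalg) : presalg :=
  xget 0 [set v | v * u = 1 /\ u * v = 1].

End PresentedAlgebra.

(* The Euclidean space E is 'cV[R]_n with the standard inner product, and its *)
(* dual E^* is 'rV[R]_n, a row a being the functional y |-> a *m y.           *)

Section RootSystem.
Variables (R : realType) (n : nat).
Local Notation E := 'cV[R]_n.
Local Notation Edual := 'rV[R]_n.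
Implicit Types (a b : Edual) (y : E) (Phi : seq Edual).

Definition ev a y : R := (a *m y) 0 0.
Definition dotE (x y : E) : R := (x^T *m y) 0 0.
Definition dotD a b : R := (a *m b^T) 0 0.

Definition coroot a : E := (2 / dotD a a) *: a^T.

Lemma corootP a y : dotE y (coroot a) = 2 * ev a y / dotD a a.
Proof.
rewrite /dotE /coroot -scalemxAr mxE -trmx_mul mxE.
by rewrite /ev mulrAC.
Qed.

(* s_a acting on E by left multiplication; b *m refl a is s_a acting on E^*.  *)
Definition refl a : 'M[R]_n := 1%:M - coroot a *m a.

Lemma reflP a y : refl a *m y = y - ev a y *: coroot a.
Proof.
by rewrite /refl mulmxBl mul1mx -mulmxA [a *m y]mx11_scalar mul_mx_scalar.
Qed.

Record irreducible_reduced_root_system Phi : Prop := {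
  rs_nonempty : Phi != [::];
  rs_nonzero : 0 \notin Phi;
  rs_refl : {in Phi &, forall a b, b *m refl a \in Phi};
  rs_int : {in Phi &, forall a b, ev b (coroot a) \is a Num.int};
  rs_reduced : forall a c, a \in Phi -> c *: a \in Phi -> c = 1 \/ c = -1;
  rs_irreducible : forall P : pred Edual,
    has P Phi -> has (predC P) Phi ->
    exists a b, [/\ a \in Phi, b \in Phi, P a, ~~ P b & dotD a b != 0] }.

Definition weyl Phi : set 'M[R]_n :=
  [set w | exists s : seq Edual,
     {subset s <= Phi} /\ w = \big[mulmx/1%:M]_(a <- s) refl a].

(* The action on E^* dual to the action of W on E.                            *)
Definition dual_act (w : 'M[R]_n) a : Edual := a *m invmx w.

Definition in_int_span (s : seq E) y : Prop := inIntSpan (in_tuple s) y.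

Record is_lattice Phi (Lambda : zmodClosed E) : Prop := {
  lattice_fg : exists s : seq E, forall y, y \in Lambda <-> in_int_span s y;
  lattice_coroot : forall y, in_int_span (map coroot Phi) y -> y \in Lambda;
  lattice_int : forall a y, a \in Phi -> y \in Lambda -> ev a y \is a Num.int }.

Section Simple.
Variables (r : nat) (simple : 'I_r -> Edual).

Record is_base Phi : Prop := {
  base_sub : forall i, simple i \in Phi;
  base_free : row_free (\matrix_(i < r) simple i);
  base_span : forall a, a \in Phi -> exists c : 'I_r -> nat,
    a = \sum_(i < r) simple i *+ c i \/ a = - \sum_(i < r) simple i *+ c i }.

Definition srefl (j : 'I_r) : 'M[R]_n := refl (simple j).

Definition word_prod (s : seq 'I_r) : 'M[R]_n :=
  \big[mulmx/1%:M]_(j <- s) srefl j.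

Definition is_reduced_word (w : 'M[R]_n) (s : seq 'I_r) : Prop :=
  word_prod s = w /\ forall s', word_prod s' = w -> (size s <= size s')%N.

Definition reduced_word w : seq 'I_r := xget [::] [set s | is_reduced_word w s].

Definition len w : nat := size (reduced_word w).

Definition is_longest Phi (w0 : 'M[R]_n) : Prop :=
  weyl Phi w0 /\ forall w, weyl Phi w -> (len w <= len w0)%N.

Definition tw (F : fieldType) (t : Edual -> F) w : F :=
  \prod_(j <- reduced_word w) t (simple j).

(* m is the order of s_i s_j. *)
Definition is_coxeter_exponent (i j : 'I_r) (m : nat) : Prop :=
  [/\ (0 < m)%N, word_prod (flatten (nseq m [:: i; j])) = 1%:M &
      forall k, (0 < k < m)%N -> word_prod (flatten (nseq k [:: i; j])) <> 1%:M].

End Simple.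
End RootSystem.

Section Lattice.
Variables (R : realType) (n : nat) (Lambda : zmodClosed 'cV[R]_n).

Definition lat : Type := {y : 'cV[R]_n | y \in Lambda}.
HB.instance Definition _ := SubChoice.on lat.
HB.instance Definition _ := [SubChoice_isSubZmodule of lat by <:].

(* When Lambda is a lattice as in [is_lattice], it contains the coroots and   *)
(* is stable under W, so the default value 0 of insubd is never used.         *)
Definition lat_of (y : 'cV[R]_n) : lat := insubd 0 y.
Definition lat_act (w : 'M[R]_n) (l : lat) : lat := lat_of (w *m \val l).

Variable (F : fieldType).
Local Notation FL := (galg F lat).

Definition xpow (l : lat) : FL := << l >>.

Definition galg_act (w : 'M[R]_n) : FL -> FL :=
  linext (fun l => xpow (lat_act w l)).

Definition iota_op : FL -> FL := linext (fun l => xpow (- l)).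

Variables (r : nat) (simple : 'I_r -> 'rV[R]_n) (t : 'rV[R]_n -> F).

(* The quotient (s_j f - f) / (x^{alpha_j^vee} - 1). *)
Definition nabla (j : 'I_r) (f : FL) : FL :=
  xget 0 [set g | g * (xpow (lat_of (coroot (simple j))) - 1)
                  = galg_act (srefl simple j) f - f].

Definition tj (j : 'I_r) : F := t (simple j).

(* Generators: T_j is inl j and x^l is inr l. *)
Local Notation free := (freealg F ('I_r + lat)%type).
Local Notation fT := (fun j : 'I_r => freegen F (inl j : ('I_r + lat)%type)).
Local Notation fX := (fun l : lat => freegen F (inr l : ('I_r + lat)%type)).

Fixpoint alt_prod (m : nat) (x y : free) : free :=
  if m is m'.+1 then x * alt_prod m' y x else 1.

Inductive hecke_rel : set free :=
| rel_braid i j m : i != j -> is_coxeter_exponent simple i j m ->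
    hecke_rel (alt_prod m (fT i) (fT j) - alt_prod m (fT j) (fT i))
| rel_quad j :
    hecke_rel ((fT j - (tj j)%:A) * (fT j + (tj j)^-1%:A))
| rel_xD l m : hecke_rel (fX l * fX m - fX (l + m))
| rel_x0 : hecke_rel (fX 0 - 1)
| rel_cross j l :
    hecke_rel (fT j * fX l - fX (lat_act (srefl simple j) l) * fT j
               - (tj j - (tj j)^-1) *: linext fX (nabla j (xpow l))).

Definition hecke := presalg hecke_rel.
HB.instance Definition _ := GRing.PzRing.on hecke.
HB.instance Definition _ := GRing.Lmodule.on hecke.

Definition hT (j : 'I_r) : hecke := presgen hecke_rel (inl j).
Definition hX : FL -> hecke := linext (fun l => presgen hecke_rel (inr l) : hecke).

Definition hTw (w : 'M[R]_n) : hecke :=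
  \prod_(j <- reduced_word simple w) hT j.

Definition hinv (h : hecke) : hecke := presinv h.

Variable Phi : seq 'rV[R]_n.

(* gamma_w(h): the coefficients of h on the basis T_w of the left             *)
(* F[Lambda]-module hecke.                                                    *)
Definition gamma (w : 'M[R]_n) (h : hecke) : FL :=
  xget (fun=> 0)
    [set c : 'M[R]_n -> FL | h = \sum_(v \in weyl Phi) hX (c v) * hTw v] w.

Definition one_plus : hecke := \sum_(w \in weyl Phi) tw simple t w *: hTw w.

Definition one_minus : hecke :=
  \sum_(w \in weyl Phi) ((-1) ^+ len simple w * (tw simple t w)^-1) *: hTw w.

Definition A_plus (w what : 'M[R]_n) (f : FL) : FL :=
  gamma w (one_plus * hX f * hTw what).

Definition A_minus (w what : 'M[R]_n) (f : FL) : FL :=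
  gamma w (one_minus * hX f * hTw what).

(* pi is a representation of the F-algebra hecke on FL, with the prescribed   *)
(* values on the generators.                                                  *)
Record is_polynomial_rep (pi : hecke -> FL -> FL) : Prop := {
  rep_linear : forall h, linear (pi h);
  rep_linearl : forall f, linear (pi^~ f);
  rep_one : forall f, pi 1 f = f;
  rep_mul : forall g h f, pi (g * h) f = pi g (pi h f);
  rep_T : forall j f, pi (hT j) f =
    tj j *: galg_act (srefl simple j) f + (tj j - (tj j)^-1) *: nabla j f;
  rep_x : forall l f, pi (hX (xpow l)) f = xpow l * f }.

End Lattice.

(* Main.v *)
(** Let e be 1^+ or 1^-. It is an eigenvector of right multiplication by each
    T_j, with eigenvalue k_j = t_j or -t_j^-1, so the cross relation gives
    e f T_j = e tau_j(f), where tau_j = k_j s_j + (t_j - t_j^-1) nabla_j.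
    Comparing the coefficients at T_v on both sides when l(v s_j) < l(v) gives
    gamma_(v s_j)(e f) = gamma_v(e sigma_j(f)), where
    sigma_j = tau_j - (t_j - t_j^-1). All coefficients are thus obtained by
    descending from v = w_0 along a reduced word of w_0 v, and the top one is
    gamma_(w_0)(T_u f) = w_0 f if u = w_0, and 0 otherwise, by triangularity.
    For 1^+ the operators tau_j, sigma_j are pi(T_j), pi(T_j^-1); for 1^- they
    are - iota pi(T_j^-1) iota, - iota pi(T_j) iota.

    The coefficients gamma_v are well defined because the T_v are independent
    over F[Lambda]: under pi they become, up to denominators, triangular
    combinations of the Weyl group elements, which act as linearly independent
    operators on the domain F[Lambda]. The independence of T_w from the chosen
    reduced word is Matsumoto's theorem, proved from the exchange condition. *)

Require Import Defs.
From HB Require Import structures.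
From mathcomp Require Import all_boot all_order all_algebra.
From mathcomp Require Import finmap.
From mathcomp Require Import boolp classical_sets fsbigop reals.
From mathcomp.multinomials Require Import monalg.
From mathcomp Require Import zify ring.

Set Implicit Arguments.
Unset Strict Implicit.
Unset Printing Implicit Defensive.

Import Order.TTheory GRing.Theory Num.Theory.
Local Open Scope ring_scope.

(** * Reflections and root systems *)

(** Roots are rows on which $W$ acts from the right, so [a *m w] is the root $w^{-1}a$. Positivity
    of [simple j *m w] thus tests $l(s_jw)>l(w)$, and right descents of $w$ are read off from
    [invmx w].

    The shift from $\tau_j$ to $\sigma_j$ is a coefficient count: if $l(vs_j)<l(v)$, then $hT_j$ has
    at $T_v$ the coefficient $\gamma_{vs_j}(h)+(t_j-t_j^{-1})\gamma_v(h)$, the second term coming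
    from the quadratic relation.

    The words of $\hat w$ and $w_0w$ are read in opposite directions. The $\tau_j$ are applied in
    the order of the letters of $\hat w$, so as operators they compose along the reversed word; the
    $\sigma_j$ compose along the word of $w_0w$ itself. For $\mathbf 1^+$ this produces $T_{\hat
    w^{-1}}$ and the inverse of $T_{(w_0w)^{-1}}$; for $\mathbf 1^-$, where $T_j$ and $T_j^{-1}$
    trade places, it produces $T_{\hat w}^{-1}$ and $T_{w_0w}$.

    [gamma] is merely a chosen coefficient function, so none of its values is known before the $T_w$
    are shown to be independent; the given representation [pi] serves for that as well. *)

Section Reflections.
Variables (R : realType) (n : nat).
Implicit Types (a b : 'rV[R]_n).

Lemma dotDE a b : dotD a b = \sum_i a 0 i * b 0 i.
Proof. by rewrite /dotD mxE; apply: eq_bigr => i _; rewrite mxE. Qed.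

Lemma dotD_gt0 a : a != 0 -> 0 < dotD a a.
Proof.
move=> a0; rewrite dotDE lt_neqAle eq_sym; apply/andP; split; last first.
  by apply: sumr_ge0 => i _; rewrite -expr2 sqr_ge0.
apply: contra a0; rewrite psumr_eq0 => [/allP aE|i _]; last by rewrite -expr2 sqr_ge0.
apply/eqP/rowP => i; rewrite mxE; apply/eqP.
by have := aE i (mem_index_enum _); rewrite /= mulf_eq0 orbb.
Qed.

Lemma ev_coroot a b : ev b (coroot a) = 2 * dotD b a / dotD a a.
Proof. by rewrite /ev /coroot -scalemxAr mxE mulrAC. Qed.

Lemma ev_coroot_diag a : a != 0 -> ev a (coroot a) = 2.
Proof. by move=> a0; rewrite ev_coroot mulfK // gt_eqF // dotD_gt0. Qed.

Lemma mulmx_refl a b : b *m refl a = b - ev b (coroot a) *: a.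
Proof.
by rewrite /refl mulmxBr mulmx1 mulmxA [b *m _]mx11_scalar mul_scalar_mx.
Qed.

Lemma mulmx_refl_diag a : a != 0 -> a *m refl a = - a.
Proof.
by move=> a0; rewrite mulmx_refl ev_coroot_diag // scaler_nat mulr2n opprD addrA subrr add0r.
Qed.

Lemma refl_invol a : a != 0 -> refl a *m refl a = 1%:M.
Proof.
move=> a0; rewrite {1}/refl mulmxBl mul1mx -mulmxA mulmx_refl_diag //.
by rewrite mulmxN opprK /refl subrK.
Qed.

Lemma trmx_refl a : (refl a)^T = refl a.
Proof.
by rewrite /refl linearB /= trmx1 trmx_mul /coroot linearZ /= trmxK -scalemxAr -scalemxAl.
Qed.

Lemma dotD_refl a b c : a != 0 -> dotD (b *m refl a) (c *m refl a) = dotD b c.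
Proof.
by move=> a0; rewrite /dotD trmx_mul trmx_refl -mulmxA [refl a *m _]mulmxA
  refl_invol // mul1mx.
Qed.

Lemma coroot_refl a b : a != 0 -> coroot (b *m refl a) = refl a *m coroot b.
Proof.
by move=> a0; rewrite /coroot dotD_refl // trmx_mul trmx_refl -scalemxAr.
Qed.

(** The conjugation rule $s_{s_ab}=s_as_bs_a$, written without inverses. *)
Lemma refl_mulmx_refl a b : a != 0 ->
  refl b *m refl a = refl a *m refl (b *m refl a).
Proof.
move=> a0; rewrite [refl b]/refl [refl (b *m _)]/refl coroot_refl //.
rewrite mulmxBl [RHS]mulmxBr mul1mx mulmx1 !mulmxA; congr (_ - _).
by rewrite refl_invol // mul1mx.
Qed.

Lemma corootN a : coroot (- a) = - coroot a.
Proof.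
by rewrite /coroot /dotD !linearN /= mulNmx opprK.
Qed.

Lemma reflN a : refl (- a) = refl a.
Proof. by rewrite /refl corootN mulNmx mulmxN opprK. Qed.

(** A root is recovered from its coroot $c$ as $2c/\|c\|^2$, because $\|c\|^2=4/\|a\|^2$. *)
Lemma coroot_inj a b : a != 0 -> b != 0 -> coroot a = coroot b -> a = b.
Proof.
move=> a0 b0 ab.
have key (c : 'rV[R]_n) : c != 0 -> c = (2 / dotE (coroot c) (coroot c)) *: (coroot c)^T.
  move=> c0; have cc : dotD c c != 0 by rewrite gt_eqF // dotD_gt0.
  have cT : (coroot c)^T = (2 / dotD c c) *: c by apply/rowP => i; rewrite !mxE.
  have -> : dotE (coroot c) (coroot c) = (2 / dotD c c) ^+ 2 * dotD c c.
    by rewrite /dotE cT /coroot -scalemxAl -scalemxAr scalerA mxE expr2.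
  rewrite cT scalerA (_ : _ * _ = 1) ?scale1r //; field.
  by rewrite cc.
by rewrite (key _ a0) (key _ b0) ab.
Qed.

End Reflections.

Section Roots.
Variables (R : realType) (n r : nat) (Phi : seq 'rV[R]_n).
Variable simple : 'I_r -> 'rV[R]_n.
Hypothesis hPhi : irreducible_reduced_root_system Phi.
Hypothesis hsimple : is_base simple Phi.
Implicit Types (a b : 'rV[R]_n) (i j : 'I_r) (s : seq 'I_r) (w : 'M[R]_n).
Local Notation s_ := (srefl simple).
Local Notation wp := (word_prod simple).
Local Notation len := (len simple).

Lemma root_neq0 a : a \in Phi -> a != 0.
Proof. by apply: contraTneq => ->; exact: rs_nonzero hPhi. Qed.

Lemma simple_root j : simple j \in Phi. Proof. exact: base_sub hsimple j. Qed.

Lemma simple_neq0 j : simple j != 0.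
Proof. by rewrite root_neq0 // simple_root. Qed.

Hint Resolve simple_root simple_neq0 : core.

Lemma rootN a : a \in Phi -> - a \in Phi.
Proof.
by move=> aP; rewrite -mulmx_refl_diag ?root_neq0 //; exact: (rs_refl hPhi aP aP).
Qed.

Lemma root_srefl a j : a \in Phi -> a *m s_ j \in Phi.
Proof. by move=> aP; apply: (rs_refl hPhi). Qed.

Lemma root_wp a s : a \in Phi -> a *m wp s \in Phi.
Proof.
rewrite /wp; elim: s a => [|j s IH] a aP; first by rewrite big_nil mulmx1.
by rewrite big_cons mulmxA; apply/IH/root_srefl.
Qed.

(** The pseudoinverse makes this a linear map on all of $E^*$; on the span of the simple roots,
    which are free, it returns the coordinates in them. *)
Definition root_coord a i : R := (a *m pinvmx (\matrix_i simple i)) 0 i.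
Definition positive a := [forall i, 0 <= root_coord a i].

Lemma root_coordD a b i : root_coord (a + b) i = root_coord a i + root_coord b i.
Proof. by rewrite /root_coord mulmxDl mxE. Qed.

Lemma root_coordZ c a i : root_coord (c *: a) i = c * root_coord a i.
Proof. by rewrite /root_coord -scalemxAl mxE. Qed.

Lemma root_coordN a i : root_coord (- a) i = - root_coord a i.
Proof. by rewrite -scaleN1r root_coordZ mulN1r. Qed.

Lemma root_coord_simple i j : root_coord (simple j) i = (i == j)%:R.
Proof.
have := mulmxKp (base_free hsimple) 1%:M; rewrite mul1mx => /matrixP /(_ j i).
rewrite -[simple j](rowK simple) /root_coord -row_mul !mxE => ->.
by rewrite eq_sym.
Qed.

Lemma root_coord_lin (c : 'I_r -> R) i : root_coord (\sum_j c j *: simple j) i = c i.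
Proof.
rewrite /root_coord mulmx_suml summxE (bigD1 i) //= big1 ?addr0.
  by rewrite -[LHS]/(root_coord _ _) root_coordZ root_coord_simple eqxx mulr1.
move=> j ji; rewrite -[LHS]/(root_coord _ _) root_coordZ root_coord_simple.
by rewrite eq_sym (negPf ji) mulr0.
Qed.

Lemma rootE a : a \in Phi -> a = \sum_j root_coord a j *: simple j.
Proof.
case/(base_span hsimple) => c [] aE.
  rewrite aE; apply: eq_bigr => j _; rewrite -scaler_nat; congr (_ *: _).
  under eq_bigr do rewrite -scaler_nat.
  by rewrite (root_coord_lin (fun j => (c j)%:R)).
rewrite [LHS]aE -sumrN; apply: eq_bigr => j _; rewrite aE root_coordN.
rewrite -scaler_nat -scaleNr; congr (- _ *: _).
under eq_bigr do rewrite -scaler_nat.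
by rewrite (root_coord_lin (fun j => (c j)%:R)).
Qed.

Lemma positiveN a : a \in Phi -> positive (- a) = ~~ positive a.
Proof.
move=> aP; apply/idP/idP => [/forallP pN|nP].
  apply/negP => /forallP pa; move/negP: (root_neq0 aP); apply; apply/eqP.
  rewrite (rootE aP) big1 // => j _; rewrite (_ : root_coord a j = 0) ?scale0r //.
  by apply/eqP; rewrite eq_le pa andbT -oppr_ge0 -root_coordN pN.
have [c []] := base_span hsimple aP => aE.
  case/negP: nP; apply/forallP => i; rewrite aE.
  under eq_bigr do rewrite -scaler_nat.
  by rewrite (root_coord_lin (fun j => (c j)%:R)) ler0n.
apply/forallP => i; rewrite aE opprK; under eq_bigr do rewrite -scaler_nat.
by rewrite (root_coord_lin (fun j => (c j)%:R)) ler0n.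
Qed.

Lemma positive_simple j : positive (simple j).
Proof. by apply/forallP => i; rewrite root_coord_simple ler0n. Qed.

Hint Resolve positive_simple : core.

Lemma simple_srefl j : simple j *m s_ j = - simple j.
Proof. exact: mulmx_refl_diag. Qed.

Lemma srefl_invol j : s_ j *m s_ j = 1%:M.
Proof. exact: refl_invol. Qed.

(** $s_j$ changes only the $j$-th coordinate. If the image were negative, all other coordinates of
    [a] would vanish, making [a] a positive multiple of $\alpha_j$, hence $\alpha_j$ itself since
    the system is reduced. *)
Lemma positive_srefl a j : a \in Phi -> positive a -> a != simple j ->
  positive (a *m s_ j).
Proof.
move=> aP pa aj; apply: contraT; rewrite -positiveN ?root_srefl // => /forallP pN.
have a0 i : i != j -> root_coord a i = 0.
  move=> ij; apply/eqP; rewrite eq_le (forallP pa) andbT.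
  have := pN i; rewrite root_coordN /srefl mulmx_refl root_coordD root_coordN root_coordZ.
  by rewrite root_coord_simple (negPf ij) mulr0 subr0 oppr_ge0.
have aE : a = root_coord a j *: simple j.
  by rewrite {1}(rootE aP) (bigD1 j) //= big1 ?addr0 // => i /a0 ->; rewrite scale0r.
have /(rs_reduced hPhi (simple_root j)) : root_coord a j *: simple j \in Phi by rewrite -aE.
case=> c1; first by rewrite aE c1 scale1r eqxx in aj.
by have := forallP pa j; rewrite c1 lerNr oppr0 ler10.
Qed.

(** * Words in the simple reflections and the exchange condition *)

Lemma wp_cons j s : wp (j :: s) = s_ j *m wp s.
Proof. by rewrite /wp big_cons. Qed.

Lemma wp_nil : wp [::] = 1%:M. Proof. by rewrite /wp big_nil. Qed.

Lemma wp_cat s1 s2 : wp (s1 ++ s2) = wp s1 *m wp s2.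
Proof.
elim: s1 => [|j s1 IH]; first by rewrite wp_nil mul1mx.
by rewrite cat_cons !wp_cons IH mulmxA.
Qed.

Lemma wp_rcons s j : wp (rcons s j) = wp s *m s_ j.
Proof. by rewrite -cats1 wp_cat wp_cons wp_nil mulmx1. Qed.

Lemma wp_rev_mul s : wp (rev s) *m wp s = 1%:M.
Proof.
elim: s => [|j s IH]; first by rewrite wp_nil mulmx1.
by rewrite rev_cons wp_rcons wp_cons mulmxA -(mulmxA _ (s_ j) (s_ j)) srefl_invol mulmx1.
Qed.

Lemma wp_unit s : wp s \in unitmx.
Proof. by case/mulmx1_unit: (wp_rev_mul s). Qed.

Lemma wp_rev s : wp (rev s) = invmx (wp s).
Proof.
by rewrite -[RHS]mul1mx -(wp_rev_mul s) -mulmxA mulmxV ?mulmx1 // wp_unit.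
Qed.

Lemma refl_wp a s : refl a *m wp s = wp s *m refl (a *m wp s).
Proof.
elim: s a => [|j s IH] a; first by rewrite wp_nil !mulmx1 mul1mx.
have e : refl a *m s_ j = s_ j *m refl (a *m s_ j) by exact: refl_mulmx_refl.
by rewrite wp_cons !mulmxA e -mulmxA IH !mulmxA.
Qed.

(** Apply the letters one at a time: at the first letter [k] that turns the root negative, the
    current root must be $\alpha_k$, the only positive root that $s_k$ makes negative. *)
Lemma sign_change a s : a \in Phi -> positive a -> ~~ positive (a *m wp s) ->
  exists s1 k s2, s = s1 ++ k :: s2 /\ a *m wp s1 = simple k.
Proof.
elim: s a => [|j s IH] a aP pa; first by rewrite wp_nil mulmx1 pa.
rewrite wp_cons mulmxA => np.
have [->|aj] := eqVneq a (simple j).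
  by exists [::], j, s; rewrite wp_nil mulmx1.
have [|s1 [k [s2 [-> E]]]] := IH _ (root_srefl j aP) _ np.
  exact: positive_srefl.
by exists (j :: s1), k, s2; rewrite wp_cons mulmxA.
Qed.

(** Moving $s_j$ through the prefix [s1] conjugates it to the reflection in [simple j *m wp s1],
    which is $\alpha_k$ at the sign change. Cancelling the two copies of $s_k$ then deletes the
    letter [k]. *)
Lemma exchange j s : ~~ positive (simple j *m wp s) ->
  exists s1 k s2, s = s1 ++ k :: s2 /\ wp (j :: s1) = wp (rcons s1 k).
Proof.
case/sign_change => // s1 [k [s2 [-> E]]]; exists s1, k, s2; split=> //.
by rewrite wp_cons wp_rcons /srefl refl_wp E.
Qed.

Lemma exchange_del j s1 k s2 : wp (j :: s1) = wp (rcons s1 k) ->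
  wp (j :: s1 ++ k :: s2) = wp (s1 ++ s2).
Proof.
by rewrite -cat_cons wp_cat => ->; rewrite wp_rcons wp_cat wp_cons -!mulmxA
  (mulmxA (s_ k)) srefl_invol mul1mx.
Qed.

Let ht a := \sum_i root_coord a i.

(** Induction on a bound for the height. As $\langle a,a\rangle>0$ and $a$ is a nonnegative
    combination of simple roots, some $\alpha_j$ has positive inner product with $a$. Then $s_ja$ is
    lower by the positive integer $a(\alpha_j^\vee)$, is still positive unless $a=\alpha_j$, and
    $s_a=s_js_{s_ja}s_j$. Since [weyl] is generated by all reflections, this is what makes words in
    the simple ones suffice. *)
Lemma positive_refl_wp (N : nat) a : a \in Phi -> positive a -> ht a <= N%:R ->
  exists s, refl a = wp s.
Proof.
elim: N a => [|N IH] a aP pa hN.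
  case/negP: (root_neq0 aP); apply/eqP; rewrite (rootE aP) big1 // => i _.
  have : ht a == 0 by rewrite eq_le hN sumr_ge0 // => j _; exact: (forallP pa).
  rewrite psumr_eq0; last by move=> j _; exact: (forallP pa).
  by move/allP/(_ i (mem_index_enum _))/eqP => ->; rewrite scale0r.
have [j dj] : exists j, 0 < dotD a (simple j).
  apply: contrapT => nex; have := dotD_gt0 (root_neq0 aP).
  rewrite {2}(rootE aP) /dotD (linear_sum (trmx (n := n))) mulmx_sumr summxE ltNge.
  rewrite sumr_le0 // => j _; rewrite linearZ /= -scalemxAr mxE.
  apply: mulr_ge0_le0; first exact: (forallP pa).
  by rewrite leNgt; apply/negP => ?; apply: nex; exists j.
have [->|aj] := eqVneq a (simple j).
  by exists [:: j]; rewrite wp_cons wp_nil mulmx1.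
have ev1 : 1 <= ev a (coroot (simple j)).
  have /intrP[z zE] := rs_int hPhi (simple_root j) aP.
  have : 0 < ev a (coroot (simple j)).
    by rewrite ev_coroot divr_gt0 ?dotD_gt0 // mulr_gt0.
  by rewrite zE ltr0z ler1z.
have htE : ht (a *m s_ j) <= N%:R.
  have -> : ht (a *m s_ j) = ht a - ev a (coroot (simple j)).
    rewrite /ht (bigD1 j) //= [in RHS](bigD1 j) //= /srefl mulmx_refl.
    rewrite root_coordD root_coordN root_coordZ root_coord_simple eqxx mulr1.
    rewrite addrAC; congr (_ + _ - _); apply: eq_bigr => i ij.
    by rewrite root_coordD root_coordN root_coordZ root_coord_simple (negPf ij) mulr0 subr0.
  by rewrite lerBlDr (le_trans hN) // -natr1 lerD2l.
have [s sE] := IH _ (root_srefl j aP) (positive_srefl aP pa aj) htE.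
exists (j :: rcons s j); rewrite wp_cons wp_rcons -sE mulmxA.
have <- : refl a *m s_ j = s_ j *m refl (a *m s_ j) by exact: refl_mulmx_refl.
by rewrite -mulmxA srefl_invol mulmx1.
Qed.

Lemma refl_wpP a : a \in Phi -> exists s, refl a = wp s.
Proof.
move=> aP; wlog pa : a aP / positive a.
  move=> H; have [|np] := boolP (positive a); first exact: H.
  by rewrite -reflN; apply: H; rewrite ?rootN ?positiveN.
apply: (@positive_refl_wp (Num.Def.archi_bound (ht a))) => //.
by rewrite ltW // archi_boundP // sumr_ge0 // => i _; exact: (forallP pa).
Qed.

Lemma weylP w : weyl Phi w <-> exists s, wp s = w.
Proof.
split=> [[l [lP ->]]|[s <-]].
  elim: l lP => [|a l IH] lP; first by exists [::]; rewrite big_nil wp_nil.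
  have [|s sE] := IH; first by move=> b bl; apply: lP; rewrite inE bl orbT.
  have [|s' s'E] := @refl_wpP a; first by apply: lP; rewrite mem_head.
  by exists (s' ++ s); rewrite big_cons wp_cat sE s'E.
exists (map simple s); split; last by rewrite /wp big_map.
by move=> a /mapP[j _ ->].
Qed.

(** * Length and reduced words *)

Lemma weyl_wp s : weyl Phi (wp s). Proof. by apply/weylP; exists s. Qed.

Lemma weyl1 : weyl Phi 1%:M. Proof. by rewrite -wp_nil; exact: weyl_wp. Qed.

Lemma weyl_mul w1 w2 : weyl Phi w1 -> weyl Phi w2 -> weyl Phi (w1 *m w2).
Proof. by move=> /weylP[s1 <-] /weylP[s2 <-]; rewrite -wp_cat; exact: weyl_wp. Qed.

Lemma weyl_unit w : weyl Phi w -> w \in unitmx.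
Proof. by move=> /weylP[s <-]; exact: wp_unit. Qed.

Lemma weyl_inv w : weyl Phi w -> weyl Phi (invmx w).
Proof. by move=> /weylP[s <-]; rewrite -wp_rev; exact: weyl_wp. Qed.

Lemma weyl_srefl j : weyl Phi (s_ j).
Proof. by rewrite -[s_ j]mulmx1 -wp_nil -wp_cons; exact: weyl_wp. Qed.

Lemma weyl_sreflL j w : weyl Phi w -> weyl Phi (s_ j *m w).
Proof. by apply: weyl_mul; exact: weyl_srefl. Qed.

Lemma weyl_sreflR j w : weyl Phi w -> weyl Phi (w *m s_ j).
Proof. by move/weyl_mul; apply; exact: weyl_srefl. Qed.

Lemma root_weyl a w : a \in Phi -> weyl Phi w -> a *m w \in Phi.
Proof. by move=> aP /weylP[s <-]; exact: root_wp. Qed.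

Lemma reduced_wordP w : weyl Phi w -> is_reduced_word simple w (reduced_word simple w).
Proof.
move=> /weylP[s0 s0E]; apply: xgetPex.
have ex : exists k, `[< exists s, wp s = w /\ size s = k >].
  by exists (size s0); apply/asboolP; exists s0.
case: (ex_minnP ex) => k /asboolP[s [sE sk]] kmin; exists s; split=> // s' s'E.
by rewrite sk kmin //; apply/asboolP; exists s'.
Qed.

Lemma wp_reduced_word w : weyl Phi w -> wp (reduced_word simple w) = w.
Proof. by case/reduced_wordP. Qed.

Lemma len_wp_le s : (len (wp s) <= size s)%N.
Proof. by case: (reduced_wordP (weyl_wp s)) => _; apply. Qed.

Lemma len_invmx w : weyl Phi w -> len (invmx w) = len w.
Proof.
have le u : weyl Phi u -> (len (invmx u) <= len u)%N.
  move=> uW; have := len_wp_le (rev (reduced_word simple u)).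
  by rewrite wp_rev size_rev wp_reduced_word.
move=> wW; apply/eqP; rewrite eqn_leq le //= -{1}[w]invmxK le //; exact: weyl_inv.
Qed.

Lemma len1 : len 1%:M = 0%N.
Proof. by apply/eqP; rewrite -leqn0 -wp_nil len_wp_le. Qed.

Lemma len_eq0 w : weyl Phi w -> len w = 0%N -> w = 1%:M.
Proof. by move=> wW /size0nil rw; rewrite -(wp_reduced_word wW) rw wp_nil. Qed.

Lemma len_sreflL_le j w : weyl Phi w -> (len (s_ j *m w) <= (len w).+1)%N.
Proof.
move=> wW; have := len_wp_le (j :: reduced_word simple w).
by rewrite wp_cons wp_reduced_word.
Qed.

Lemma sreflLK j w : s_ j *m (s_ j *m w) = w.
Proof. by rewrite mulmxA srefl_invol mul1mx. Qed.

Lemma sreflRK m j (w : 'M[R]_(m, n)) : w *m s_ j *m s_ j = w.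
Proof. by rewrite -mulmxA srefl_invol mulmx1. Qed.

(** The exchange condition deletes a letter from a reduced word of $w$, giving a word of $s_jw$ that
    is one letter shorter. *)
Lemma len_sreflL_neg j w : weyl Phi w -> ~~ positive (simple j *m w) ->
  len w = (len (s_ j *m w)).+1.
Proof.
move=> wW; have := wp_reduced_word wW; rewrite /len.
set s := reduced_word simple w => sE; rewrite -{1}sE.
case/exchange => s1 [k [s2 [s12 /exchange_del-/(_ s2)]]].
rewrite -s12 wp_cons sE => wE; apply/eqP; rewrite eqn_leq -/(len _) -/(len w).
rewrite -{1}[w](sreflLK j) (len_sreflL_le _ (weyl_sreflL j wW)) /=.
rewrite wE /len -/s s12 !size_cat /= addnS ltnS -size_cat; exact: len_wp_le.
Qed.

Lemma len_sreflL_pos j w : weyl Phi w -> positive (simple j *m w) ->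
  len (s_ j *m w) = (len w).+1.
Proof.
move=> wW pw; rewrite (@len_sreflL_neg j _ (weyl_sreflL j wW)) ?sreflLK //.
by rewrite mulmxA simple_srefl mulNmx positiveN ?(root_weyl _ wW) // pw.
Qed.

Lemma positive_lt_len j w : weyl Phi w ->
  positive (simple j *m w) = (len w < len (s_ j *m w))%N.
Proof.
move=> wW; have [pw|nw] := boolP (positive _); first by rewrite len_sreflL_pos // ltnS leqnn.
by rewrite (len_sreflL_neg wW nw) ltnNge leqnSn.
Qed.

Lemma invmx_sreflR j w : weyl Phi w -> invmx (w *m s_ j) = s_ j *m invmx w.
Proof. by move=> /weylP[s <-]; rewrite -wp_rcons -!wp_rev rev_rcons wp_cons. Qed.

Lemma len_sreflR_neg j w : weyl Phi w -> ~~ positive (simple j *m invmx w) ->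
  len w = (len (w *m s_ j)).+1.
Proof.
move=> wW nw; rewrite -len_invmx // (len_sreflL_neg (weyl_inv wW) nw).
by rewrite -invmx_sreflR // len_invmx //; exact: weyl_sreflR.
Qed.

Lemma len_sreflR_pos j w : weyl Phi w -> positive (simple j *m invmx w) ->
  len (w *m s_ j) = (len w).+1.
Proof.
move=> wW pw; rewrite -(len_invmx wW) -(len_sreflL_pos (weyl_inv wW) pw).
by rewrite -invmx_sreflR // len_invmx //; exact: weyl_sreflR.
Qed.

Lemma positive_sreflR j w : weyl Phi w ->
  positive (simple j *m invmx (w *m s_ j)) = ~~ positive (simple j *m invmx w).
Proof.
move=> wW; rewrite invmx_sreflR // mulmxA simple_srefl mulNmx positiveN //.
by rewrite root_weyl //; exact: weyl_inv.
Qed.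

Lemma positive_sreflL j w : weyl Phi w ->
  positive (simple j *m (s_ j *m w)) = ~~ positive (simple j *m w).
Proof. by move=> wW; rewrite mulmxA simple_srefl mulNmx positiveN // (root_weyl _ wW). Qed.

Definition reduced s := size s == len (wp s).

Lemma reduced_reduced_word w : weyl Phi w -> reduced (reduced_word simple w).
Proof. by move=> wW; rewrite /reduced wp_reduced_word. Qed.

Lemma reduced_behead j s : reduced (j :: s) -> reduced s.
Proof.
rewrite /reduced wp_cons /= => /eqP js; rewrite eqn_leq len_wp_le andbT.
by rewrite -ltnS js len_sreflL_le //; exact: weyl_wp.
Qed.

Lemma reduced_cons_pos j s : reduced (j :: s) -> positive (simple j *m wp s).
Proof.
move=> js; rewrite positive_lt_len; last exact: weyl_wp.
by rewrite -wp_cons -(eqP js) -(eqP (reduced_behead js)).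
Qed.

Lemma reduced_rev s : reduced s -> reduced (rev s).
Proof. by rewrite /reduced size_rev wp_rev len_invmx //; exact: weyl_wp. Qed.

Lemma weyl_eq1 w : weyl Phi w -> (forall j, positive (simple j *m w)) -> w = 1%:M.
Proof.
move=> wW pw; apply: len_eq0 => //; have := reduced_reduced_word wW.
have := wp_reduced_word wW; rewrite /len.
case: (reduced_word simple w) => // j s wE /reduced_cons_pos.
rewrite -[positive _]negbK -positive_sreflL; last exact: weyl_wp.
by rewrite -wp_cons wE pw.
Qed.

(** * Alternating words and Matsumoto's theorem *)

Fixpoint alt (m : nat) i j : seq 'I_r := if m is m'.+1 then i :: alt m' j i else [::].

Lemma size_alt m i j : size (alt m i j) = m.
Proof. by elim: m i j => //= m IH i j; rewrite IH. Qed.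

Lemma alt_doubleS m i j : rcons (alt m.*2 i j) i = alt m.*2.+1 i j.
Proof. by elim: m => //= m ->. Qed.

Lemma alt_cat_rev m i j : alt m i j ++ rev (alt m j i) = alt m.*2 i j.
Proof.
elim: m i j => //= m IH i j; rewrite rev_cons -cats1 catA IH cats1.
by rewrite alt_doubleS.
Qed.

Lemma alt_take p m i j : (p <= m)%N -> take p (alt m i j) = alt p i j.
Proof. by elim: p m i j => [|p IH] [|m] //= i j pm; rewrite IH. Qed.

(** The word of $(s_is_j)^m$ is one alternating word followed by the reverse of the other, and
    reversing a word inverts its product. *)
Lemma wp_alt_double m i j :
  wp (flatten (nseq m [:: i; j])) = 1%:M <-> wp (alt m i j) = wp (alt m j i).
Proof.
have -> : flatten (nseq m [:: i; j]) = alt m.*2 i j by elim: m => //= m ->.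
rewrite -alt_cat_rev wp_cat wp_rev; split=> [E|->]; last by rewrite mulmxV ?wp_unit.
by rewrite -[LHS](mulmxKV (wp_unit (alt m j i))) E mul1mx.
Qed.

(* The exchange condition lengthens the alternating prefix by one letter, unless
   the deleted letter lies in the prefix, which forces a dihedral relation. *)
Lemma alt_prefix q i j w : weyl Phi w ->
  ~~ positive (simple i *m w) -> ~~ positive (simple j *m w) ->
  (forall k, (0 < k < q)%N -> wp (alt k i j) <> wp (alt k j i)) ->
  exists s, wp (alt q i j ++ s) = w /\ (q + size s = len w)%N.
Proof.
move=> wW; elim: q i j => [|q IH] i j ni nj nalt.
  by exists (reduced_word simple w); rewrite wp_reduced_word.
(* The letters swap roles: a prefix starting with [j] is what the descent [i] can be put in front
   of. *)
have [|s [sE ss]] := IH j i nj ni.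
  by move=> k /andP[k0 kq] E; apply: (nalt k) => //; rewrite k0 ltnW.
have := ni; rewrite -{1}sE => /exchange[s1 [k [s2 [s12 E]]]].
have [lt_s1|ge_s1] := ltnP (size s1) q.
  have s1E : s1 = alt (size s1) j i.
    by rewrite -(alt_take _ _ (ltnW lt_s1)) -(takel_cat s) ?size_alt ?(ltnW lt_s1) //
      s12 take_size_cat.
  have s1kE : rcons s1 k = alt (size s1).+1 j i.
    by rewrite -(alt_take _ _ lt_s1) -(takel_cat s) ?size_alt // s12 -cat_rcons
      take_size_cat ?size_rcons.
  case: (nalt (size s1).+1); first exact: lt_s1.
  by rewrite -s1kE -E /= -s1E.
have s1E : s1 = alt q j i ++ drop q s1.
  by rewrite -{1}(cat_take_drop q s1) -(takel_cat (k :: s2)) // -s12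
    take_size_cat ?size_alt.
exists (drop q s1 ++ s2); split; last first.
  rewrite -ss; move: (congr1 size s12); rewrite !size_cat size_alt /= size_drop; lia.
rewrite /= wp_cons catA -s1E -(exchange_del _ E) -s12 wp_cons sE sreflLK //.
Qed.

(** The two alternating products must agree at some length, since otherwise [alt_prefix] would give
    $w$ an alternating prefix longer than $l(w)$. The least such length is the order of $s_is_j$,
    and up to it [alt_prefix] applies. *)
Lemma coxeter_prefix i j w : weyl Phi w ->
  ~~ positive (simple i *m w) -> ~~ positive (simple j *m w) ->
  exists m s, [/\ (0 < m)%N, is_coxeter_exponent simple i j m,
    wp (alt m i j) = wp (alt m j i), wp (alt m i j ++ s) = w
    & (m + size s = len w)%N].
Proof.
move=> wW ni nj.
have ex : exists m, (0 < m)%N && (wp (alt m i j) == wp (alt m j i)).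
  apply: contrapT => nex; have [|s [_]] := @alt_prefix (len w).+1 i j w wW ni nj.
    by move=> k /andP[k0 _] E; apply: nex; exists k; rewrite k0 E eqxx.
  by rewrite addSn => /eqP; rewrite gtn_eqF // ltnS leq_addr.
case: (ex_minnP ex) => m /andP[m0 /eqP mE] mmin.
have nalt k : (0 < k < m)%N -> wp (alt k i j) <> wp (alt k j i).
  move=> /andP[k0 km] E; have := mmin k; rewrite k0 E eqxx => /(_ isT).
  by rewrite leqNgt km.
have [s [sE ss]] := alt_prefix wW ni nj nalt; exists m, s; split=> //.
by split=> // [|k km]; [apply/wp_alt_double | move/wp_alt_double/(nalt k km)].
Qed.

(** Induction on length. If the first letters [i] and [j] differ, both are left descents of the
    element, so it has reduced words beginning with either alternating word of length $m$ and ending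
    in the same [s]. The braid relation identifies their products, and each of the remaining
    comparisons is between words with the same first letter. *)
Lemma matsumoto (A : pzRingType) (g : 'I_r -> A) :
  (forall i j m, i != j -> is_coxeter_exponent simple i j m ->
     \prod_(k <- alt m i j) g k = \prod_(k <- alt m j i) g k) ->
  forall s s', reduced s -> reduced s' -> wp s = wp s' ->
  \prod_(k <- s) g k = \prod_(k <- s') g k.
Proof.
move=> braid s; have [N] := ubnP (size s); elim: N s => // N IH [|i u] /= sN s' rs rs' E.
  by move: rs'; rewrite /reduced -E -(eqP rs) => /nilP ->.
case: s' rs' E => [|j u'] rs' E.
  by move: (rs); rewrite /reduced E -(eqP rs').
have tailE k v v' : reduced (k :: v) -> reduced (k :: v') -> wp (k :: v) = wp (k :: v') ->
    (size v < N)%N -> \prod_(l <- k :: v) g l = \prod_(l <- k :: v') g l.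
  move=> /reduced_behead rv /reduced_behead rv' vv' vN.
  rewrite !big_cons (IH v vN v') //.
  by rewrite -[LHS](sreflLK k) -wp_cons vv' wp_cons sreflLK.
have [ij|ij] := eqVneq i j; first by rewrite -ij in rs' E *; exact: tailE.
have wW := weyl_wp (i :: u).
have negl k v : reduced (k :: v) -> ~~ positive (simple k *m wp (k :: v)).
  move=> rv; rewrite wp_cons positive_sreflL ?negbK ?reduced_cons_pos //.
  exact: weyl_wp.
have nj : ~~ positive (simple j *m wp (i :: u)) by rewrite E negl.
have [[|m] [s [m0 mC mE sE ms]]] := coxeter_prefix wW (negl _ _ rs) nj; first by [].
have sE' : wp (alt m.+1 j i ++ s) = wp (i :: u) by rewrite -sE !wp_cat mE.
have rij : reduced (alt m.+1 i j ++ s) by rewrite /reduced sE size_cat size_alt ms.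
have rji : reduced (alt m.+1 j i ++ s) by rewrite /reduced sE' size_cat size_alt ms.
rewrite (tailE i u (alt m j i ++ s)) //.
rewrite -(tailE j (alt m i j ++ s) u') //; first last.
- by move: sN ms; rewrite size_cat size_alt -(eqP rs) /=; lia.
- by rewrite -E.
by rewrite -!cat_cons !big_cat /= -/(alt m.+1 i j) -/(alt m.+1 j i) (braid _ _ _ ij mC).
Qed.

(* The right-hand side does not depend on the reduced word: with [phi = t] this
   gives [tw], and with [phi = 1] the length. *)
Lemma big_reduced (T : Type) (idx : T) (op : Monoid.com_law idx) (phi : 'rV[R]_n -> T) :
  (forall a j, a \in Phi -> phi (a *m s_ j) = phi a) ->
  forall s, reduced s ->
  \big[op/idx]_(j <- s) phi (simple j) =
  \big[op/idx]_(b <- undup Phi | positive b && ~~ positive (b *m wp s)) phi b.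
Proof.
move=> phiW; elim=> [|j s IH] rs.
  by rewrite big_nil big_pred0 // => b; rewrite wp_nil mulmx1 andbN.
have ps := reduced_cons_pos rs.
have uw w : uniq [seq b <- undup Phi | positive b && ~~ positive (b *m w)].
  by rewrite filter_uniq ?undup_uniq.
rewrite big_cons (IH (reduced_behead rs)) -[RHS]big_filter.
rewrite [RHS](bigD1_seq (simple j)) ?uw //=; last first.
  rewrite mem_filter mem_undup simple_root positive_simple wp_cons.
  by rewrite positive_sreflL ?ps //; exact: weyl_wp.
congr (op _ _); rewrite -big_filter -[RHS]big_filter.
set l := filter _ _; set l' := filter _ (filter _ _).
have lP b : (b \in l) = [&& b \in Phi, positive b & ~~ positive (b *m wp s)].
  by rewrite mem_filter mem_undup andbC.
have l'P b : (b \in l') =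
    [&& b \in Phi, positive b, ~~ positive (b *m s_ j *m wp s) & b != simple j].
  rewrite !mem_filter mem_undup wp_cons mulmxA andbC.
  by case: (b \in Phi); rewrite ?andbF ?andbT // -andbA.
(* Prepending [j] moves the inversions of the tail by $s_j$ and adds one new inversion, $\alpha_j$,
   which has been split off above. *)
rewrite [RHS](perm_big [seq b *m s_ j | b <- l]) /=.
  rewrite big_map big_seq [RHS]big_seq; apply: eq_bigr => b.
  by rewrite lP => /and3P[bP _ _]; rewrite phiW.
apply: uniq_perm; first by rewrite filter_uniq ?uw.
  rewrite map_inj_uniq ?uw //.
  by move=> a b E; rewrite -[a](sreflRK j) E sreflRK.
move=> b; rewrite l'P; apply/idP/mapP => [/and4P[bP pb nb bj]|[c]].
  exists (b *m s_ j); last by rewrite sreflRK.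
  by rewrite lP root_srefl ?positive_srefl.
rewrite lP => /and3P[cP pc nc] ->; rewrite root_srefl //= sreflRK nc /=.
rewrite positive_srefl //=; last by apply: contraNneq nc => ->.
apply/eqP => E; move: pc; rewrite -[c](sreflRK j) E simple_srefl.
by rewrite positiveN // positive_simple.
Qed.

Lemma reduced_size s : reduced s -> (size s <= size (undup Phi))%N.
Proof.
move=> /(big_reduced addn (phi := fun=> 1%N)) E.
by rewrite -sum1_size E // sum1_count count_size.
Qed.

(** Finiteness of $W$: reduced words have at most as many letters as there are roots. *)
Lemma weyl_enum : exists Ws : seq 'M[R]_n, uniq Ws /\ forall w, weyl Phi w <-> w \in Ws.
Proof.
exists (undup (flatten [seq [seq wp (tval t) | t : k.-tuple 'I_r]
                       | k <- iota 0 (size (undup Phi)).+1])).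
split=> [|w]; first exact: undup_uniq.
rewrite mem_undup; split=> [wW|/flatten_mapP[k _ /mapP[t _ ->]]]; last exact: weyl_wp.
have rw := reduced_reduced_word wW.
apply/flatten_mapP; exists (len w); first by rewrite mem_iota add0n ltnS (reduced_size rw).
apply/mapP; exists (in_tuple (reduced_word simple w)); first by rewrite mem_enum.
by rewrite wp_reduced_word.
Qed.

Section Longest.
Variable w0 : 'M[R]_n.
Hypothesis hw0 : is_longest simple Phi w0.

Lemma weyl_longest : weyl Phi w0. Proof. by case: hw0. Qed.

(** Maximality of $l(w_0)$ makes every $s_j$ a left descent, so every simple root becomes negative;
    linearity carries this to all positive roots. *)
Lemma positive_longest a : a \in Phi -> positive (a *m w0) = ~~ positive a.
Proof.
have sneg j : positive (- (simple j *m w0)).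
  rewrite positiveN ?(root_weyl _ weyl_longest) //.
  rewrite (positive_lt_len _ weyl_longest) -leqNgt.
  by apply: (proj2 hw0); apply/weyl_sreflL/weyl_longest.
have key b : b \in Phi -> positive b -> ~~ positive (b *m w0).
  move=> bP pb; rewrite -positiveN ?(root_weyl _ weyl_longest) //; apply/forallP => i.
  rewrite {1}(rootE bP) mulmx_suml -sumrN /root_coord mulmx_suml summxE sumr_ge0 // => j _.
  rewrite -scalemxAl -scalerN -[X in 0 <= X]/(root_coord _ i) root_coordZ.
  by rewrite mulr_ge0 ?(forallP pb) ?(forallP (sneg j)).
move=> aP; have [pa|na] := boolP (positive a); first by apply/negbTE/key.
have := key (- a) (rootN aP); rewrite positiveN // na mulNmx positiveN ?negbK.
  exact.
exact: root_weyl aP weyl_longest.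
Qed.

Lemma longest_invol : w0 *m w0 = 1%:M.
Proof.
have wW := weyl_longest; apply: weyl_eq1; first exact: weyl_mul.
by move=> j; rewrite mulmxA !positive_longest ?(root_weyl _ wW) // positive_simple.
Qed.

(** Multiplication by $w_0$ swaps right ascents and right descents: as a reduced word of $w_0v$
    grows on the right, $v$ goes down from $w_0$. *)
Lemma positive_longest_mul j w : weyl Phi w ->
  positive (simple j *m invmx (w0 *m w)) = ~~ positive (simple j *m invmx w).
Proof.
move=> wW; rewrite -positive_longest ?(root_weyl _ (weyl_inv wW)) //; congr positive.
have [u0 u] := (weyl_unit weyl_longest, weyl_unit wW).
rewrite -mulmxA; congr (_ *m _); rewrite -[RHS](mulmxK (weyl_unit (weyl_mul weyl_longest wW))).
by rewrite -(mulmxA (invmx w)) (mulmxA w0 w0 w) longest_invol mul1mx mulVmx // mul1mx.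
Qed.

End Longest.

Lemma coroot_wp a s : coroot (a *m wp s) = invmx (wp s) *m coroot a.
Proof.
elim: s a => [|j s IH] a; first by rewrite wp_nil mulmx1 invmx1 mul1mx.
rewrite wp_cons mulmxA IH coroot_refl // mulmxA -!wp_rev -[refl _]/(s_ j).
by rewrite -wp_rcons -rev_cons wp_rev wp_cons.
Qed.

(** Fixing the simple coroots means fixing the simple roots, so $w^{-1}$ has no descent. Coroots are
    used for the test because they lie in every $\Lambda$. *)
Lemma weyl_faithful w : weyl Phi w ->
  (forall j, w *m coroot (simple j) = coroot (simple j)) -> w = 1%:M.
Proof.
move=> /weylP[s <-] fix_; rewrite -[LHS]invmxK -[RHS]invmx1; congr invmx.
rewrite -wp_rev; apply: weyl_eq1; first exact: weyl_wp.
move=> j; suff -> : simple j *m wp (rev s) = simple j by exact: positive_simple.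
apply: coroot_inj => //; first by rewrite root_neq0 // root_wp.
by rewrite coroot_wp wp_rev invmxK.
Qed.

End Roots.

(** * The group algebra *)

(* Take phi = (1, x, .., x^(n-1)) with x avoiding the roots of the polynomials
   whose coefficient vectors are the given vectors. *)
Lemma separating_functional (R : realType) n (vs : seq 'cV[R]_n) : 0 \notin vs ->
  exists phi : 'rV[R]_n, forall v, v \in vs -> ev phi v != 0.
Proof.
move=> vs0; pose p := \prod_(v <- vs) rVpoly v^T.
have p0 : p != 0.
  rewrite prodf_seq_neq0; apply/allP => v vvs /=; apply: contraNneq vs0 => v0.
  suff <- : v = 0 by [].
  by rewrite -[v]trmxK -[v^T]rVpolyK v0 linear0 trmx0.
have [x px] : exists x, p.[x] != 0.
  (* As many distinct points as the size of [p], one more than its degree, so they cannot all be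
     roots. *)
  apply: contrapT => nex; pose rs : seq R := [seq k%:R | k <- iota 0 (size p)].
  have := @max_poly_roots _ p rs p0; rewrite size_map size_iota ltnn => H.
  have : false by apply: H;
    [apply/allP => y _; apply: contrapT => /negP py; apply: nex; exists y
    |rewrite map_inj_uniq ?iota_uniq // => i j /eqP; rewrite eqr_nat => /eqP].
  by [].
exists (\row_i x ^+ i) => v vvs; move: px; rewrite horner_prod prodf_seq_neq0.
move=> /allP/(_ v vvs) /=; rewrite /rVpoly horner_poly; congr (_ != _).
rewrite /ev mxE; apply: eq_bigr => i _; rewrite insubT // => ilt.
by rewrite !mxE mulrC (_ : Sub _ _ = i) //; exact: val_inj.
Qed.

Lemma seq_argmax (T : eqType) (R : realType) (phi : T -> R) (s : seq T) : s != [::] ->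
  exists2 x, x \in s & forall y, y \in s -> phi y <= phi x.
Proof.
elim: s => // a [|b s] IH _.
  by exists a; rewrite ?mem_head // => y; rewrite inE => /eqP ->.
have [//|x xs xmax] := IH; have [ax|xa] := leP (phi a) (phi x).
  exists x; first by rewrite inE xs orbT.
  by move=> y; rewrite inE => /predU1P[->|/xmax].
exists a; first exact: mem_head.
move=> y; rewrite inE => /predU1P[->//|/xmax yx].
exact: le_trans yx (ltW xa).
Qed.

Section GalgDomain.
Variables (R : realType) (n : nat) (Lambda : zmodClosed 'cV[R]_n) (F : fieldType).
Local Notation FL := (galg F (lat Lambda)).

Lemma mcoeff_galg_mul (f g : FL) k :
  (f * g)@_k = \sum_(a <- msupp f) \sum_(b <- msupp g) f@_a * g@_b *+ (a + b == k).
Proof.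
rewrite -[f * g]/(galg_mul f g) /galg_mul /linext raddf_sum /=.
apply: eq_bigr => a _; rewrite mcoeffZ raddf_sum mulr_sumr; apply: eq_bigr => b _.
by rewrite /= mcoeffZ mcoeffU mulrA mulrnAr mulr1.
Qed.

(** Exponents lie in a real vector space, so a linear functional that is injective on the finitely
    many exponents involved orders them, and the product of the two top terms cannot cancel. *)
Lemma galg_mul_eq0 (f g : FL) : f * g = 0 -> f = 0 \/ g = 0.
Proof.
move=> fg0; apply: contrapT => /not_orP[/eqP f0 /eqP g0].
pose ls : seq (lat Lambda) := msupp f ++ msupp g.
(* Not vanishing on the nonzero differences is the same as being injective on [ls]. *)
pose ds := [seq \val d | d <- [seq a - b | a <- ls, b <- ls] & d != 0].
have [|phi phiP] := @separating_functional R n ds.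
  apply/negP => /mapP[d]; rewrite mem_filter => /andP[d0 _] /esym vd0.
  by case/negP: d0; apply/eqP/val_inj.
pose ph (l : lat Lambda) := ev phi (\val l).
have phD a b : ph (a + b) = ph a + ph b by rewrite /ph /ev mulmxDr mxE.
have ph_inj a b : a \in ls -> b \in ls -> ph a = ph b -> a = b.
  move=> als bls; apply: contra_eq => ab; rewrite -subr_eq0.
  have -> : ph a - ph b = ph (a - b) by rewrite -{1}(subrK b a) [ph (_ + b)]phD addrK.
  apply: phiP; apply/mapP; exists (a - b) => //.
  by rewrite mem_filter subr_eq0 ab; apply/allpairsP; exists (a, b).
have ne (h : FL) : h != 0 -> (msupp h : seq _) != [::].
  apply: contraNneq => h0; apply/eqP/malgP => l; rewrite mcoeff0 mcoeff_outdom //.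
  by rewrite -[_ \in _]/(l \in (msupp h : seq _)) h0.
have [x xf xmax] := @seq_argmax _ _ ph _ (ne f f0).
have [y yg ymax] := @seq_argmax _ _ ph _ (ne g g0).
have inl a : a \in msupp f -> a \in ls by rewrite mem_cat => ->.
have inr a : a \in msupp g -> a \in ls by rewrite mem_cat => ->; rewrite orbT.
have := congr1 (fun h : FL => h@_(x + y)) fg0; rewrite mcoeff_galg_mul mcoeff0.
rewrite (bigD1_seq x) ?fset_uniq //= (bigD1_seq y) ?fset_uniq //= eqxx.
rewrite big1_seq ?addr0 => [|b /andP[yb bg]]; last first.
  by rewrite (inj_eq (addrI x)) (negPf yb).
rewrite big1_seq ?addr0 => [/eqP|a /andP[xa af]]; last first.
  rewrite big1_seq // => b /andP[_ bg]; case: eqP => // /(congr1 ph).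
  rewrite !phD => E; case/negP: xa; apply/eqP/ph_inj; rewrite ?inl //.
  by apply/eqP; rewrite eq_le xmax // -(lerD2r (ph b)) E lerD2l ymax.
by rewrite mulr1n mulf_eq0 !mcoeff_eq0 xf yg.
Qed.

Lemma galg_mulIr (d f g : FL) : d != 0 -> f * d = g * d -> f = g.
Proof.
move=> d0 fg; have : (f - g) * d = 0 by rewrite mulrBl fg subrr.
by case/galg_mul_eq0 => [/eqP|dE]; [rewrite subr_eq0 => /eqP | rewrite dE eqxx in d0].
Qed.

End GalgDomain.

(** * The Weyl group action and divided differences on the group algebra *)

Section Action.
Variables (R : realType) (n r : nat) (Phi : seq 'rV[R]_n).
Variables (simple : 'I_r -> 'rV[R]_n) (Lambda : zmodClosed 'cV[R]_n) (F : fieldType).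
Hypothesis hPhi : irreducible_reduced_root_system Phi.
Hypothesis hsimple : is_base simple Phi.
Hypothesis hLambda : is_lattice Phi Lambda.
Implicit Types (w : 'M[R]_n) (j : 'I_r) (l m : lat Lambda) (a : 'rV[R]_n).
Local Notation FL := (galg F (lat Lambda)).
Local Notation s_ := (srefl simple).
Local Notation act := (@galg_act R n Lambda F).
Local Notation iota := (@iota_op R n Lambda F).
Local Notation nab := (@nabla R n Lambda F r simple).
Local Notation x_ := (@xpow R n Lambda F).

Lemma coroot_lattice a : a \in Phi -> coroot a \in Lambda.
Proof.
move=> aP; apply: (lattice_coroot hLambda); set cs := map _ _.
have ic : (index (coroot a) cs < size cs)%N by rewrite index_mem map_f.
exists [ffun i => (i == Ordinal ic)%:Z]; rewrite (bigD1 (Ordinal ic)) //= ffunE eqxx.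
rewrite big1 => [|i /negPf ni]; last by rewrite ffunE ni.
by rewrite addr0 nth_index // map_f.
Qed.

Lemma weyl_lattice w y : weyl Phi w -> y \in Lambda -> w *m y \in Lambda.
Proof.
move=> /(weylP hPhi hsimple)[s <-]; elim: s y => [|j s IH] y yL.
  by rewrite wp_nil mul1mx.
have aP := base_sub hsimple j.
rewrite wp_cons -mulmxA reflP; set z := _ *m y; have zL : z \in Lambda by exact: IH.
have /intrP[k ->] := lattice_int hLambda aP zL.
by rewrite rpredB // scaler_int rpredMz // coroot_lattice.
Qed.

Lemma val_lat_act w l : weyl Phi w -> \val (lat_act w l) = w *m \val l.
Proof. by move=> wW; rewrite /lat_act /lat_of insubdK // weyl_lattice // (valP l). Qed.

Lemma val_cr j : \val (lat_of Lambda (coroot (simple j))) = coroot (simple j).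
Proof. by rewrite /lat_of insubdK // coroot_lattice // (base_sub hsimple). Qed.

Lemma lat_actD w l m : weyl Phi w -> lat_act w (l + m) = lat_act w l + lat_act w m.
Proof. by move=> wW; apply: val_inj; rewrite /= !val_lat_act //= mulmxDr. Qed.

Lemma lat_actN w l : weyl Phi w -> lat_act w (- l) = - lat_act w l.
Proof. by move=> wW; apply: val_inj; rewrite /= !val_lat_act //= mulmxN. Qed.

Lemma lat_actM w1 w2 l : weyl Phi w1 -> weyl Phi w2 ->
  lat_act (w1 *m w2) l = lat_act w1 (lat_act w2 l).
Proof.
move=> w1W w2W; apply: val_inj; rewrite !val_lat_act ?mulmxA //.
exact: (weyl_mul hPhi hsimple).
Qed.

Lemma lat_act1 l : lat_act 1%:M l = l.
Proof. by apply: val_inj; rewrite val_lat_act ?mul1mx //; exact: (weyl1 hPhi hsimple). Qed.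

HB.instance Definition _ w :=
  GRing.isLinear.Build F FL FL *:%R (act w) (linext_is_linear _).
HB.instance Definition _ :=
  GRing.isLinear.Build F FL FL *:%R iota (linext_is_linear _).

Lemma galg_actU w l : act w (x_ l) = x_ (lat_act w l).
Proof. exact: linextU. Qed.

Lemma iotaU l : iota (x_ l) = x_ (- l). Proof. exact: linextU. Qed.

Lemma xpowD l m : x_ (l + m) = x_ l * x_ m.
Proof. exact: esym (galg_mulU F l m). Qed.

Lemma xpow0 : x_ 0 = 1. Proof. by []. Qed.

Lemma galg_eqP (f g : FL -> FL) : linear f -> linear g ->
  (forall l, f (x_ l) = g (x_ l)) -> f =1 g.
Proof.
move=> fL gL fg h; elim/galg_ind: h => [c h1 h2 E1 E2||l]; last exact: fg.
  by rewrite fL gL E1 E2.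
have f0 (k : FL -> FL) : linear k -> k 0 = 0.
  by move=> kL; have := kL (-1) 0 0; rewrite !scaleN1r !addNr.
by rewrite !f0.
Qed.

Lemma galg_actM w (f g : FL) : weyl Phi w -> act w (f * g) = act w f * act w g.
Proof.
move=> wW; move: f; apply: galg_eqP => [c f1 f2|c f1 f2|l].
- by rewrite mulrDl -scalerAl linearP.
- by rewrite linearP mulrDl -scalerAl.
apply: (@galg_eqP (fun g => act w (x_ l * g)) (fun g => act w (x_ l) * act w g)) g.
- by move=> c f1 f2; rewrite mulrDr -scalerAr linearP.
- by move=> c f1 f2; rewrite linearP mulrDr -scalerAr.
move=> m; rewrite -(xpowD l m) [LHS]galg_actU lat_actD // xpowD.
by congr (_ * _); rewrite galg_actU.
Qed.

Lemma galg_act1 w : weyl Phi w -> act w 1 = 1.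
Proof.
move=> wW; transitivity (act w (x_ 0)); first by [].
rewrite galg_actU; have -> : lat_act w (0 : lat Lambda) = 0; last by [].
by apply: val_inj; rewrite val_lat_act //= mulmx0.
Qed.

Lemma galg_act_comp w1 w2 f : weyl Phi w1 -> weyl Phi w2 ->
  act (w1 *m w2) f = act w1 (act w2 f).
Proof.
move=> w1W w2W; move: f; apply: galg_eqP => [c f1 f2|c f1 f2|l].
- by rewrite !linearP.
- by rewrite ?linearP.
by rewrite !galg_actU lat_actM.
Qed.

Lemma galg_act_id f : act 1%:M f = f.
Proof.
move: f; apply: galg_eqP => [c f1 f2|c f1 f2|l].
- by rewrite !linearP.
- by rewrite ?linearP.
by rewrite galg_actU lat_act1.
Qed.

Lemma iotaM f g : iota (f * g) = iota f * iota g.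
Proof.
move: f; apply: galg_eqP => [c f1 f2|c f1 f2|l].
- by rewrite mulrDl -scalerAl linearP.
- by rewrite linearP mulrDl -scalerAl.
apply: (@galg_eqP (fun g => iota (x_ l * g)) (fun g => iota (x_ l) * iota g)) g.
- by move=> c f1 f2; rewrite mulrDr -scalerAr linearP.
- by move=> c f1 f2; rewrite linearP mulrDr -scalerAr.
move=> m; rewrite -(xpowD l m) [LHS]iotaU opprD xpowD.
by congr (_ * _); rewrite iotaU.
Qed.

Lemma iota1 : iota 1 = 1. Proof. by transitivity (iota (x_ 0)); rewrite // iotaU oppr0. Qed.

Lemma iotaK : involutive iota.
Proof.
apply: galg_eqP => [c f1 f2|c f1 f2|l].
- by rewrite !linearP.
- by rewrite ?linearP.
by rewrite [X in iota X]iotaU [LHS]iotaU opprK.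
Qed.

Lemma iota_act w f : weyl Phi w -> iota (act w f) = act w (iota f).
Proof.
move=> wW; move: f; apply: galg_eqP => [c f1 f2|c f1 f2|l].
- by rewrite !linearP.
- by rewrite ?linearP.
by rewrite [X in iota X]galg_actU [LHS]iotaU [X in act w X]iotaU [RHS]galg_actU lat_actN.
Qed.

Definition rdiv j : FL := x_ (lat_of Lambda (coroot (simple j))) - 1.

Lemma lat_of_coroot_neq0 j : lat_of Lambda (coroot (simple j)) != 0.
Proof.
apply/eqP => /(congr1 val); rewrite val_cr /= => /eqP.
rewrite /coroot scaler_eq0 mulf_eq0 invr_eq0 pnatr_eq0 /=.
have a0 : simple j != 0 by exact: (simple_neq0 hPhi hsimple).
rewrite gt_eqF ?dotD_gt0 //=.
by apply/negP; apply: contra a0 => /eqP E; rewrite -[simple j]trmxK E trmx0.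
Qed.

Lemma xpow_inj : injective x_.
Proof.
move=> l m lm; have xE k : (x_ k)@_m = (k == m)%:R by exact: mcoeffU.
have [//|nlm] := eqVneq l m; have := xE l; rewrite lm xE (negPf nlm) eq_refl.
by move/eqP; rewrite oner_eq0.
Qed.

Lemma rdiv_neq0 j : rdiv j != 0.
Proof.
rewrite subr_eq0 -xpow0 (inj_eq xpow_inj); exact: lat_of_coroot_neq0.
Qed.

(** A geometric sum for $k\ge 0$; for negative $k$ use $x^{-\mu}-1=-x^{-\mu}(x^\mu-1)$. *)
Lemma xpow_sub1_dvd (k : int) l : exists g, x_ (l *~ k) - 1 = g * (x_ l - 1).
Proof.
have xn (p : nat) : x_ (l *+ p) = x_ l ^+ p.
  by elim: p => // p IH; rewrite mulrS xpowD IH exprS.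
have nat_case (p : nat) : exists g, x_ (l *+ p) - 1 = g * (x_ l - 1).
  by rewrite xn subrX1 mulrC; eexists.
case: k => p; first exact: nat_case.
have [g gE] := nat_case p.+1; exists (- x_ (- (l *+ p.+1)) * g).
have -> : l *~ Negz p = - (l *+ p.+1) by [].
have yz : x_ (- (l *+ p.+1)) * x_ (l *+ p.+1) = 1 by rewrite -(xpowD (- _)) addNr.
have key (y z h d : FL) : y * z = 1 -> z - 1 = h * d -> y - 1 = - y * h * d.
  by move=> e1 e2; rewrite -mulrA -e2 mulrBr mulr1 mulNr e1 opprK addrC.
exact: key yz gE.
Qed.

(** On a basis element, $s_jx^\lambda-x^\lambda=x^\lambda(x^{-k\alpha_j^\vee}-1)$ with
    $k=\alpha_j(\lambda)$, an integer because $\Lambda$ is a lattice. Hence the default value in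
    [nabla] is never taken. *)
Lemma nabla_ex j f : exists g, g * rdiv j = act (s_ j) f - f.
Proof.
elim/galg_ind: f => [c f1 f2 [g1 E1] [g2 E2]||l].
- exists (c *: g1 + g2); rewrite mulrDl -scalerAl E1 E2 linearP scalerBr.
  by rewrite opprD addrACA.
- by exists 0; rewrite mul0r linear0 subr0.
have sW := weyl_srefl hPhi hsimple j.
have /intrP[k kE] := lattice_int hLambda (base_sub hsimple j) (valP l).
have lE : lat_act (s_ j) l = l + lat_of Lambda (coroot (simple j)) *~ (- k).
  apply: val_inj; rewrite val_lat_act // reflP kE.
  rewrite [RHS]raddfD /= [X in _ = _ + X](raddfMz (\val : lat Lambda -> _)).
  by rewrite [X in _ = _ + X *~ _]val_cr scaler_int mulrNz.
have [g gE] := xpow_sub1_dvd (- k) (lat_of Lambda (coroot (simple j))).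
have aE : act (s_ j) (x_ l) = x_ l * x_ (lat_of Lambda (coroot (simple j)) *~ (- k)).
  rewrite galg_actU lE; exact: xpowD.
exists (x_ l * g); rewrite -[<< l >>]/(x_ l) aE -mulrA -gE.
have key (y z : FL) : y * (z - 1) = y * z - y by rewrite mulrBr mulr1.
exact: key.
Qed.

Lemma nablaP j f : nab j f * rdiv j = act (s_ j) f - f.
Proof. by have /(xgetPex 0) := nabla_ex j f. Qed.

Lemma nabla_eq j f g : g * rdiv j = act (s_ j) f - f -> nab j f = g.
Proof.
by move=> gE; apply: (galg_mulIr (rdiv_neq0 j)); rewrite nablaP gE.
Qed.

Lemma nabla_is_linear j : linear (nab j).
Proof.
move=> c f g; apply: nabla_eq.
by rewrite mulrDl -scalerAl !nablaP linearP scalerBr opprD addrACA.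
Qed.

(** $\iota$ turns the denominator into $x^{-\alpha_j^\vee}-1$, so the left side is
    $-x^{\alpha_j^\vee}\nabla_j(f)=-(x^{\alpha_j^\vee}-1)\nabla_j(f)-\nabla_j(f)$. This identity is
    what brings the operators attached to $\mathbf 1^-$ back to $\pi$. *)
Lemma iota_nabla j f : iota (nab j (iota f)) = f - act (s_ j) f - nab j f.
Proof.
apply: (galg_mulIr (rdiv_neq0 j)).
have sW := weyl_srefl hPhi hsimple j.
set c := lat_of Lambda (coroot (simple j)).
have iD : iota (rdiv j) = x_ (- c) - 1.
  by rewrite /rdiv linearB; congr (_ - _); [exact: iotaU | exact: iota1].
have E : iota (nab j (iota f)) * (x_ (- c) - 1) = act (s_ j) f - f.
  transitivity (iota (nab j (iota f) * rdiv j)); first by rewrite iotaM iD.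
  rewrite nablaP; transitivity (iota (act (s_ j) (iota f)) - iota (iota f)).
    exact: (linearB iota).
  have E1 := etrans (iota_act (iota f) sW) (congr1 (act (s_ j)) (iotaK f)).
  exact: (congr2 (fun g h => g - h) E1 (iotaK f)).
have yx : x_ (- c) * x_ c = 1 by rewrite -(xpowD (- c)) addNr.
rewrite mulrBl nablaP.
have key (N y d g : FL) : y * d = 1 -> N * (y - 1) = g - f ->
    N * (d - 1) = (f - g) * (d - 1) - (g - f).
  move=> yd Ng; have -> : N * (d - 1) = - (N * (y - 1)) * d.
    by rewrite !mulrBr !mulr1 opprB mulrBl -mulrA yd mulr1.
  by rewrite Ng; ring.
exact: key yx E.
Qed.

End Action.

(** * Expansions of symmetrizers in the Hecke algebra *)

(* Scalars of [H] are accessed through the image of [F] under [X], since a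
   presented algebra need not be nontrivial and is therefore no [algType]. *)
Section Demazure.
Variables (R : realType) (n r : nat) (Phi : seq 'rV[R]_n).
Variable simple : 'I_r -> 'rV[R]_n.
Hypothesis hPhi : irreducible_reduced_root_system Phi.
Hypothesis hsimple : is_base simple Phi.
Variables (F : fieldType) (A : comAlgType F) (H : pzRingType).
Hypothesis A_domain : forall f g : A, f * g = 0 -> f = 0 \/ g = 0.

Local Notation s_ := (srefl simple).
Local Notation wp := (word_prod simple).
Local Notation W := (weyl Phi).
Local Notation len := (len simple).
Local Notation reduced := (reduced simple).
Local Notation desc j w := (~~ positive simple (simple j *m w)).
Implicit Types (j k : 'I_r) (s : seq 'I_r) (u v w : 'M[R]_n) (f g : A) (h : H).

Variable t : 'rV[R]_n -> F.
Hypothesis t_neq0 : forall j, t (simple j) != 0.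
Hypothesis t_srefl : forall a j, a \in Phi -> t (a *m s_ j) = t a.
Local Notation tj j := (t (simple j)).
Local Notation qd j := (tj j - (tj j)^-1).
Local Notation tw := (tw simple t).

Variable act : 'M[R]_n -> {linear A -> A}.
Hypothesis actM : forall w f g, W w -> act w (f * g) = act w f * act w g.
Hypothesis act1 : forall w, W w -> act w 1 = 1.
Hypothesis act_comp : forall w1 w2 f, W w1 -> W w2 -> act (w1 *m w2) f = act w1 (act w2 f).
Hypothesis act_id : forall f, act 1%:M f = f.
Hypothesis act_faithful : forall w, W w -> (forall f, act w f = f) -> w = 1%:M.

Variables (D : 'I_r -> A) (nab : 'I_r -> {linear A -> A}).
Hypothesis D_nonscalar : forall j c, D j != c%:A.
Hypothesis nabP : forall j f, nab j f * D j = act (s_ j) f - f.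

Variables (X : {rmorphism A -> H}) (T : 'I_r -> H).
Local Notation sc c := (X (c%:A)).
Hypothesis sc_central : forall c h, sc c * h = h * sc c.
Hypothesis T_sq : forall j, T j * T j = sc (qd j) * T j + 1.
Hypothesis T_braid : forall i j m, i != j -> is_coxeter_exponent simple i j m ->
  \prod_(k <- alt m i j) T k = \prod_(k <- alt m j i) T k.
Hypothesis T_X : forall j f, T j * X f = X (act (s_ j) f) * T j + X (qd j *: nab j f).

Definition Tw w : H := \prod_(j <- reduced_word simple w) T j.

Let weyl_wp s : W (wp s). Proof. exact: weyl_wp hPhi hsimple s. Qed.
Let weylL j w : W w -> W (s_ j *m w). Proof. exact: weyl_sreflL. Qed.
Let weylR j w : W w -> W (w *m s_ j). Proof. exact: weyl_sreflR. Qed.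
Let weyls j : W (s_ j). Proof. exact: weyl_srefl. Qed.

Lemma Tw_reduced s : reduced s -> Tw (wp s) = \prod_(k <- s) T k.
Proof.
move=> rs; apply: (matsumoto hPhi hsimple T_braid) => //.
  exact: (reduced_reduced_word hPhi hsimple).
exact: (wp_reduced_word hPhi hsimple).
Qed.

Lemma Tw1 : Tw 1%:M = 1.
Proof.
rewrite -(wp_nil simple) Tw_reduced ?big_nil //.
by rewrite /reduced wp_nil (len1 hPhi hsimple).
Qed.

Lemma reduced_cons j w : W w -> positive simple (simple j *m w) ->
  reduced (j :: reduced_word simple w) /\ wp (j :: reduced_word simple w) = s_ j *m w.
Proof.
move=> wW pw; have E := wp_reduced_word hPhi hsimple wW.
by rewrite /reduced wp_cons E /= (len_sreflL_pos hPhi hsimple).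
Qed.

Lemma reduced_rcons j w : W w -> positive simple (simple j *m invmx w) ->
  reduced (rcons (reduced_word simple w) j) /\
  wp (rcons (reduced_word simple w) j) = w *m s_ j.
Proof.
move=> wW pw; have E := wp_reduced_word hPhi hsimple wW.
by rewrite /reduced wp_rcons E size_rcons (len_sreflR_pos hPhi hsimple).
Qed.

Lemma T_Tw_pos j w : W w -> positive simple (simple j *m w) -> T j * Tw w = Tw (s_ j *m w).
Proof.
move=> wW /(reduced_cons wW)[rs <-].
by rewrite Tw_reduced // big_cons.
Qed.

Lemma Tw_T_pos j w : W w -> positive simple (simple j *m invmx w) -> Tw w * T j = Tw (w *m s_ j).
Proof.
move=> wW /(reduced_rcons wW)[rs <-].
by rewrite Tw_reduced // -cats1 big_cat big_seq1.
Qed.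

Lemma T_Tw j w : W w ->
  T j * Tw w = Tw (s_ j *m w) + (if desc j w then sc (qd j) * Tw w else 0).
Proof.
move=> wW; case: ifPn => [nw|/negPn pw]; last by rewrite addr0 T_Tw_pos.
have pw : positive simple (simple j *m (s_ j *m w)) by rewrite (positive_sreflL hPhi hsimple).
have E : Tw w = T j * Tw (s_ j *m w) by rewrite T_Tw_pos ?(sreflLK hPhi hsimple) //; exact: weylL.
by rewrite E mulrA T_sq mulrDl mul1r -mulrA addrC.
Qed.

Lemma Tw_T j w : W w ->
  Tw w * T j = Tw (w *m s_ j) + (if desc j (invmx w) then sc (qd j) * Tw w else 0).
Proof.
move=> wW; case: ifPn => [nw|/negPn pw]; last by rewrite addr0 Tw_T_pos.
have pw : positive simple (simple j *m invmx (w *m s_ j)) by rewrite (positive_sreflR hPhi hsimple).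
have E : Tw w = Tw (w *m s_ j) * T j by rewrite Tw_T_pos ?(sreflRK hPhi hsimple) //; exact: weylR.
by rewrite {1}E -mulrA T_sq mulrDr mulr1 addrC mulrA -sc_central -mulrA -E.
Qed.

Variable Ws : seq 'M[R]_n.
Hypothesis Ws_uniq : uniq Ws.
Hypothesis WsP : forall w, W w <-> w \in Ws.

Lemma sum_sreflL (V : nmodType) (G : 'M[R]_n -> V) j :
  \sum_(v <- Ws) G v = \sum_(v <- Ws) G (s_ j *m v).
Proof.
rewrite -(big_map (mulmx (s_ j)) xpredT G); apply: perm_big.
apply: uniq_perm => // [|v].
  rewrite map_inj_uniq // => u v E.
  by rewrite -[u](sreflLK hPhi hsimple j) E (sreflLK hPhi hsimple).
apply/idP/mapP => [/WsP vW|[u /WsP uW ->]]; last exact/WsP/weylL.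
by exists (s_ j *m v); [exact/WsP/weylL | rewrite (sreflLK hPhi hsimple)].
Qed.

Lemma sum_sreflR (V : nmodType) (G : 'M[R]_n -> V) j :
  \sum_(v <- Ws) G v = \sum_(v <- Ws) G (v *m s_ j).
Proof.
rewrite -(big_map (mulmx^~ (s_ j)) xpredT G); apply: perm_big.
apply: uniq_perm => // [|v].
  rewrite map_inj_uniq // => u v E.
  by rewrite -[u](sreflRK hPhi hsimple j) E (sreflRK hPhi hsimple).
apply/idP/mapP => [/WsP vW|[u /WsP uW ->]]; last exact/WsP/weylR.
by exists (v *m s_ j); [exact/WsP/weylR | rewrite (sreflRK hPhi hsimple)].
Qed.

Definition expand (c : 'M[R]_n -> A) : H := \sum_(v <- Ws) X (c v) * Tw v.

(** $T_v$ receives a term from $T_{vs_j}T_j$ in every case, and one from $T_vT_j$ through the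
    quadratic relation exactly when $s_j$ is a right descent of $v$. *)
Lemma expand_mulT c j : expand c * T j =
  expand (fun v => c (v *m s_ j) + (if desc j (invmx v) then qd j *: c v else 0)).
Proof.
rewrite /expand mulr_suml.
have -> : \sum_(v <- Ws) X (c v) * Tw v * T j = \sum_(v <- Ws) (X (c v) * Tw (v *m s_ j)
    + X (if desc j (invmx v) then qd j *: c v else 0) * Tw v).
  rewrite !big_seq; apply: eq_bigr => v /WsP vW.
  rewrite -mulrA Tw_T // mulrDr; congr (_ + _); case: ifP => _; last by rewrite mulr0 rmorph0 mul0r.
  by rewrite -[qd j *: c v]mulr_algl rmorphM mulrA sc_central.
rewrite big_split /= (sum_sreflR _ j) -big_split /=; apply: eq_bigr => v _.
by rewrite (sreflRK hPhi hsimple) rmorphD mulrDl.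
Qed.

Lemma T_expand c j : T j * expand c =
  expand (fun v => act (s_ j) (c (s_ j *m v)) + qd j *: nab j (c v) +
                   (if desc j v then qd j *: act (s_ j) (c v) else 0)).
Proof.
rewrite /expand mulr_sumr.
have -> : \sum_(v <- Ws) T j * (X (c v) * Tw v) =
    \sum_(v <- Ws) (X (act (s_ j) (c v)) * Tw (s_ j *m v)
    + X (qd j *: nab j (c v) + if desc j v then qd j *: act (s_ j) (c v) else 0) * Tw v).
  rewrite !big_seq; apply: eq_bigr => v /WsP vW.
  rewrite mulrA T_X mulrDl -mulrA T_Tw // mulrDr rmorphD mulrDl -!addrA; congr (_ + _).
  rewrite addrC; congr (_ + _); case: ifP => _; last by rewrite mulr0 rmorph0 mul0r.
  by rewrite -[_ *: act _ _]mulr_algl rmorphM mulrA sc_central.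
rewrite big_split /= (sum_sreflL _ j) -big_split /=; apply: eq_bigr => v _.
by rewrite (sreflLK hPhi hsimple) -mulrDl -rmorphD addrA.
Qed.

(** Triangularity by length alone, without the Bruhat order: besides $T_w$, only elements strictly
    shorter than $w$ occur. Multiplying by $T_j$ on the left raises length by at most one, and the
    divided difference and quadratic terms keep $v$ fixed. *)
Lemma Tw_X_wp s f : reduced s -> exists c, [/\ Tw (wp s) * X f = expand c,
  c (wp s) = act (wp s) f
  & forall v, W v -> (size s <= len v)%N -> v != wp s -> c v = 0].
Proof.
elim: s => [|j s IH] rs.
  exists (fun v => if v == 1%:M then f else 0); rewrite wp_nil eqxx act_id; split=> //.
    have W1 : 1%:M \in Ws by apply/WsP; exact: (weyl1 hPhi hsimple).
    rewrite Tw1 mul1r /expand (bigD1_seq 1%:M) //= eqxx Tw1 mulr1 big1 ?addr0 //.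
    by move=> v /negPf ->; rewrite rmorph0 mul0r.
  by move=> v _ _ /negPf ->.
have rs' := reduced_behead hPhi hsimple rs.
have [c [cE ctop clow]] := IH rs'.
have ps := reduced_cons_pos hPhi hsimple rs.
have c0 v : W v -> (size s < len v)%N -> c v = 0.
  move=> vW sv; apply: clow => //; first exact: ltnW.
  by apply: contraTneq sv => ->; rewrite -leqNgt (len_wp_le hPhi hsimple).
eexists; split.
- by rewrite Tw_reduced // big_cons -Tw_reduced // -mulrA cE T_expand.
- rewrite wp_cons (sreflLK hPhi hsimple) ctop c0 ?linear0 ?scaler0 ?addr0 ?if_same.
  + by rewrite addr0 act_comp.
  + exact: weylL.
  + by rewrite -wp_cons -(eqP rs).
move=> v vW lv nv /=; rewrite (c0 v) // !linear0 ?scaler0 if_same !addr0.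
rewrite clow ?linear0 //; first exact: weylL.
  have := len_sreflL_le hPhi hsimple j (weylL j vW).
  by rewrite (sreflLK hPhi hsimple) => /(leq_trans lv).
by apply: contra nv => /eqP E; rewrite -[v](sreflLK hPhi hsimple j) E wp_cons.
Qed.

Lemma Tw_X w f : W w -> exists c, [/\ Tw w * X f = expand c, c w = act w f
  & forall v, W v -> (len w <= len v)%N -> v != w -> c v = 0].
Proof.
move=> wW; have := Tw_X_wp f (reduced_reduced_word hPhi hsimple wW).
by rewrite (wp_reduced_word hPhi hsimple).
Qed.

(** Dedekind's argument for independence of characters: apply the relation to $gf$ and subtract
    $u_0(g)$ times the relation at $f$. This removes $u_0$, and faithfulness supplies a $g$ on which
    $u$ and $u_0$ differ. *)
Lemma act_indep (Us : seq 'M[R]_n) (e : 'M[R]_n -> A) : uniq Us -> {in Us, forall u, W u} ->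
  (forall f, \sum_(u <- Us) e u * act u f = 0) -> {in Us, forall u, e u = 0}.
Proof.
elim: Us e => // u0 Us IH e /= /andP[u0Us uUs] UsW eq0.
have uW0 := UsW u0 (mem_head _ _).
have UsW' : {in Us, forall u, W u} by move=> u uU; apply: UsW; rewrite inE uU orbT.
have e0 : {in Us, forall u, e u = 0}.
  move=> u uU; have uW := UsW' u uU.
  have [g ng] : exists g, act u g != act u0 g.
    apply: contrapT => nex; case/negP: u0Us; suff <- : u = u0 by [].
    have iW := weyl_inv hPhi hsimple uW0; have iU := weyl_unit hPhi hsimple uW0.
    suff E : invmx u0 *m u = 1%:M by rewrite -[u]mul1mx -(mulmxV iU) -mulmxA E mulmx1.
    apply: act_faithful => [|f]; first exact: (weyl_mul hPhi hsimple).
    rewrite act_comp // (_ : act u f = act u0 f) -?act_comp ?mulVmx //.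
    by apply: contrapT => /eqP ne; apply: nex; exists f.
  have : e u * (act u g - act u0 g) = 0.
    apply: (IH (fun v => e v * (act v g - act u0 g))) => // f.
    have := congr2 (fun a b => a - act u0 g * b) (eq0 (g * f)) (eq0 f).
    rewrite mulr0 subr0 mulr_sumr -sumrB big_cons actM //.
    rewrite (_ : e u0 * _ - _ = 0) ?add0r; last by ring.
    move=> E; rewrite -[RHS]E !big_seq; apply: eq_bigr => v /UsW' vW; rewrite actM //; ring.
  by case/A_domain => // /eqP; rewrite subr_eq0 (negPf ng).
move=> u; rewrite inE => /predU1P[->|/e0 //].
have := eq0 1; rewrite big_cons big1_seq ?addr0 ?act1 ?mulr1 // => v /e0 ->.
by rewrite mul0r.
Qed.

Variable pi : H -> A -> A.
Hypothesis piDl : forall h1 h2 f, pi (h1 + h2) f = pi h1 f + pi h2 f.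
Hypothesis pi1 : forall f, pi 1 f = f.
Hypothesis piM : forall h1 h2 f, pi (h1 * h2) f = pi h1 (pi h2 f).
Hypothesis piT : forall j f, pi (T j) f = tj j *: act (s_ j) f + qd j *: nab j f.
Hypothesis piX : forall g f, pi (X g) f = g * f.

Lemma pi0l f : pi 0 f = 0.
Proof. by apply: (addrI (pi 0 f)); rewrite -piDl !addr0. Qed.

Lemma pi_sum (I : Type) (l : seq I) (h : I -> H) f :
  pi (\sum_(i <- l) h i) f = \sum_(i <- l) pi (h i) f.
Proof. by elim: l => [|i l IH]; rewrite ?big_nil ?pi0l // !big_cons piDl IH. Qed.

Lemma mul_neq0 f g : f != 0 -> g != 0 -> f * g != 0.
Proof. by move=> f0 g0; apply/eqP => /A_domain[] /eqP; rewrite ?(negPf f0) ?(negPf g0). Qed.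

Lemma D_neq0 j : D j != 0.
Proof. by have := D_nonscalar j 0; rewrite scale0r. Qed.

Lemma act_neq0 j f : f != 0 -> act (s_ j) f != 0.
Proof.
apply: contraNneq => sf; rewrite -[f]act_id -(srefl_invol hPhi hsimple j).
by rewrite act_comp ?sf ?linear0.
Qed.

(* The operators [pi (Tw w)] become combinations of the [act u] only after
   clearing the denominators [D j] of the divided differences. *)
Lemma pi_Tw_top_wp s : reduced s -> exists (d : A) (b : 'M[R]_n -> A), [/\ d != 0, b (wp s) != 0,
  forall v, W v -> (size s <= len v)%N -> v != wp s -> b v = 0
  & forall f, d * pi (Tw (wp s)) f = \sum_(v <- Ws) b v * act v f].
Proof.
elim: s => [|j s IH] rs.
  exists 1, (fun v => (v == 1%:M)%:R); rewrite wp_nil eqxx !oner_eq0; split=> //.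
    by move=> v _ _ /negPf ->.
  move=> f; have W1 : 1%:M \in Ws by apply/WsP; exact: (weyl1 hPhi hsimple).
  rewrite Tw1 pi1 mul1r (bigD1_seq 1%:M) //= eqxx mul1r act_id big1 ?addr0 //.
  by move=> v /negPf ->; rewrite mul0r.
have rs' := reduced_behead hPhi hsimple rs.
have [d [b [d0 btop blow bE]]] := IH rs'.
have ps := reduced_cons_pos hPhi hsimple rs.
have b0 v : W v -> (size s < len v)%N -> b v = 0.
  move=> vW sv; apply: blow => //; first exact: ltnW.
  by apply: contraTneq sv => ->; rewrite -leqNgt (len_wp_le hPhi hsimple).
(* After multiplication by $D_j$, this is the coefficient of $s_j$ in $\pi(T_j)$; it could vanish
   only if $D_j$ were a scalar. *)
pose a := tj j *: D j + (qd j)%:A.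
have a0 : a != 0.
  apply: contra (D_nonscalar j (- ((tj j)^-1 * qd j))) => /eqP/(congr1 (GRing.scale (tj j)^-1)).
  rewrite scaler0 scalerDr !scalerA mulVf // scale1r => /eqP.
  by rewrite addr_eq0 -scaleNr.
(* $D_j$ clears the divided difference in $\pi(T_j)$. Of the two terms left, the one carrying $s_j$
   has denominator $s_jd$ and the other has denominator $d$. *)
exists (D j * act (s_ j) d * d),
  (fun v => a * d * act (s_ j) (b (s_ j *m v)) - (qd j)%:A * act (s_ j) d * b v); split.
- by rewrite !mul_neq0 ?act_neq0 ?D_neq0.
- rewrite wp_cons (sreflLK hPhi hsimple) (b0 (s_ j *m wp s)) ?mulr0 ?subr0.
  + by rewrite !mul_neq0 ?act_neq0.
  + exact: weylL.
  + by rewrite -wp_cons -(eqP rs).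
- move=> v vW lv nv; rewrite (b0 v) // blow ?linear0 ?mulr0 ?subr0 //; first exact: weylL.
    have := len_sreflL_le hPhi hsimple j (weylL j vW).
    by rewrite (sreflLK hPhi hsimple) => /(leq_trans lv).
  by apply: contra nv => /eqP E; rewrite -[v](sreflLK hPhi hsimple j) E wp_cons.
move=> f; rewrite Tw_reduced // big_cons -Tw_reduced // piM; set g := pi (Tw _) f.
have -> : D j * act (s_ j) d * d * pi (T j) g =
    a * d * act (s_ j) (d * g) - (qd j)%:A * act (s_ j) d * (d * g).
  have Dpi : D j * pi (T j) g = a * act (s_ j) g - (qd j)%:A * g.
    rewrite piT mulrDr -!scalerAr [D j * nab j g]mulrC nabP scalerBr.
    by rewrite mulrDl -scalerAl !mulr_algl addrA.
  transitivity (act (s_ j) d * d * (D j * pi (T j) g)); first by ring.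
  by rewrite Dpi actM //; ring.
rewrite bE raddf_sum !mulr_sumr.
have -> : \sum_(v <- Ws) a * d * act (s_ j) (b v * act v f) =
    \sum_(v <- Ws) a * d * act (s_ j) (b (s_ j *m v)) * act v f.
  rewrite [RHS](sum_sreflL _ j) !big_seq; apply: eq_bigr => v /WsP vW.
  by rewrite (sreflLK hPhi hsimple) actM // act_comp // mulrA.
by rewrite -sumrB; apply: eq_bigr => v _; rewrite mulrBl mulrA.
Qed.

(** Membership in $W$ stands under the existential so that choice yields functions on all
    matrices. *)
Lemma pi_Tw_top w : exists p : A * ('M[R]_n -> A), W w -> [/\ p.1 != 0, p.2 w != 0,
  forall v, W v -> (len w <= len v)%N -> v != w -> p.2 v = 0
  & forall f, p.1 * pi (Tw w) f = \sum_(v <- Ws) p.2 v * act v f].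
Proof.
have [wW|nW] := pselect (W w); last by exists (0, fun=> 0).
have [d [b]] := pi_Tw_top_wp (reduced_reduced_word hPhi hsimple wW).
by rewrite (wp_reduced_word hPhi hsimple) // => ?; exists (d, b).
Qed.

(** Multiplied by the product [Q] of all denominators, the relation becomes $\sum_x e_x\,x=0$
    between Weyl group operators, so $e=0$. If $u$ has maximal length in the support of [c], only
    $T_u$ contributes to $e_u$, and its contribution is nonzero. *)
Lemma expand_eq0 c : expand c = 0 -> forall w, W w -> c w = 0.
Proof.
move=> c0 w wW; apply: contrapT => /eqP cw.
have [p pP] := boolp.choice pi_Tw_top.
have wf : w \in [seq v <- Ws | c v != 0] by rewrite mem_filter cw; apply/WsP.
have [|u] := @seq_argmax _ R (fun v => (len v)%:R) [seq v <- Ws | c v != 0].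
  by case: [seq _ <- _ | _] wf.
rewrite mem_filter => /andP[cu uWs] umax; have /WsP uW := uWs.
pose P v := \prod_(x <- Ws | x != v) (p x).1.
pose Q := \prod_(x <- Ws) (p x).1.
have PE v : v \in Ws -> P v * (p v).1 = Q.
  by move=> vWs; rewrite /Q (bigD1_seq v) //= mulrC.
have P_neq0 : P u != 0.
  rewrite /P big_seq_cond; elim/big_rec: _ => [|x f /andP[/WsP xW _] f0]; first exact: oner_neq0.
  by rewrite mul_neq0 //; case: (pP x xW).
pose e x := \sum_(v <- Ws) c v * P v * (p v).2 x.
have e0 : e u = 0.
  apply: (@act_indep Ws e) => // [x /WsP //|f].
  transitivity (\sum_(v <- Ws) c v * P v * ((p v).1 * pi (Tw v) f)).
    under eq_bigr do rewrite mulr_suml; rewrite exchange_big /= !big_seq.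
    apply: eq_bigr => v /WsP vW; have [_ _ _ ->] := pP v vW.
    by rewrite mulr_sumr; apply: eq_bigr => x _; rewrite mulrA.
  transitivity (Q * pi (expand c) f).
    rewrite /expand pi_sum mulr_sumr !big_seq; apply: eq_bigr => v vWs.
    by rewrite piM piX -(PE v) //; ring.
  by rewrite c0 pi0l mulr0.
have [_ pu _ _] := pP u uW.
have : c u * P u * (p u).2 u != 0 by rewrite !mul_neq0.
rewrite -e0 /e (bigD1_seq u) //= big1_seq ?addr0 ?eqxx // => v /andP[vu vWs].
have [->|cv] := eqVneq (c v) 0; first by rewrite !mul0r.
have /WsP vW := vWs; have [_ _ plow _] := pP v vW.
rewrite plow ?mulr0 // 1?eq_sym //.
by rewrite -(ler_nat R); apply: umax; rewrite mem_filter cv.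
Qed.

Lemma expand_inj c c' : expand c = expand c' -> forall w, W w -> c w = c' w.
Proof.
move=> E w wW; apply/eqP; rewrite -subr_eq0; apply/eqP.
apply: (@expand_eq0 (fun v => c v - c' v)) => //.
rewrite /expand; under eq_bigr do rewrite rmorphB mulrBl.
by rewrite sumrB -/(expand c) E subrr.
Qed.

Variable w0 : 'M[R]_n.
Hypothesis hw0 : is_longest simple Phi w0.
Let w0W : W w0 := weyl_longest hw0.

Lemma act_srefl_invol j f : act (s_ j) (act (s_ j) f) = f.
Proof. by rewrite -act_comp // (srefl_invol hPhi hsimple) act_id. Qed.

Lemma nab_act j f : nab j (act (s_ j) f) = - nab j f.
Proof.
apply/eqP; rewrite -addr_eq0; apply/eqP.
have : (nab j (act (s_ j) f) + nab j f) * D j = 0.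
  by rewrite mulrDl !nabP act_srefl_invol addrA subrK subrr.
by case/A_domain => // /eqP; rewrite (negPf (D_neq0 j)).
Qed.

Lemma XZ a f : X (a *: f) = sc a * X f.
Proof. by rewrite -[a *: f]mulr_algl rmorphM. Qed.

Lemma sc_expand a c : sc a * expand c = expand (fun v => a *: c v).
Proof. by rewrite /expand mulr_sumr; apply: eq_bigr => v _; rewrite XZ mulrA. Qed.

Lemma expandD c c' : expand c + expand c' = expand (fun v => c v + c' v).
Proof. by rewrite /expand -big_split /=; apply: eq_bigr => v _; rewrite rmorphD mulrDl. Qed.

Lemma eq_expand c c' : (forall v, W v -> c v = c' v) -> expand c = expand c'.
Proof. by move=> E; rewrite /expand !big_seq; apply: eq_bigr => v /WsP vW; rewrite E. Qed.

(** * Moving Hecke generators through a symmetrizer *)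

Definition tau (kappa : 'I_r -> F) j f := kappa j *: act (s_ j) f + qd j *: nab j f.
Definition sigma (kappa : 'I_r -> F) j f := tau kappa j f - qd j *: f.

Section Symmetrizer.
Variables (kappa : 'I_r -> F) (c : 'M[R]_n -> F).
Let e : H := expand (fun v => (c v)%:A).
Hypothesis e_T : forall j, e * T j = sc (kappa j) * e.

(** The cross relation is used at $s_jf$, which puts $T_j$ on the left of the function, where [e]
    absorbs it; $\nabla_j(s_jf)=-\nabla_j(f)$ restores the sign. *)
Lemma symmetrizer_X_T j f : e * X f * T j = e * X (tau kappa j f).
Proof.
have -> : e * X f * T j = e * (X f * T j) by rewrite mulrA.
have -> : X f * T j = T j * X (act (s_ j) f) + X (qd j *: nab j f).
  by rewrite T_X act_srefl_invol nab_act scalerN rmorphN addrNK.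
by rewrite mulrDr mulrA e_T sc_central -mulrA -XZ -mulrDr -rmorphD.
Qed.

Lemma symmetrizer_X_prod f s :
  e * X f * \prod_(k <- s) T k = e * X (foldl (fun g k => tau kappa k g) f s).
Proof.
elim: s f => [|k s IH] f; first by rewrite big_nil mulr1.
by rewrite big_cons mulrA symmetrizer_X_T IH.
Qed.

Lemma symmetrizer_top f : exists b, e * X f = expand b /\ b w0 = c w0 *: act w0 f.
Proof.
have ex u : exists b, W u -> [/\ Tw u * X f = expand b, b u = act u f
    & forall v, W v -> (len u <= len v)%N -> v != u -> b v = 0].
  by have [/(Tw_X f)[b]|] := pselect (W u); [exists b | exists (fun=> 0)].
have [b bP] := boolp.choice ex.
exists (fun v => \sum_(u <- Ws) c u *: b u v); split.
  rewrite /e /expand mulr_suml.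
  under [RHS]eq_bigr do rewrite raddf_sum mulr_suml.
  rewrite exchange_big /= !big_seq; apply: eq_bigr => u /WsP uW.
  have [E _ _] := bP u uW; rewrite -mulrA E /expand mulr_sumr.
  by apply: eq_bigr => v _; rewrite [in RHS]XZ mulrA.
rewrite (bigD1_seq w0) //=; last exact/WsP.
rewrite big1_seq ?addr0 => [|u /andP[uw0 /WsP uW]]; first by have [_ -> _] := bP w0 w0W.
by have [_ _ ->] := bP u uW; rewrite ?scaler0 // 1?eq_sym //; case: hw0 => _; apply.
Qed.

Lemma symmetrizer_expand f what : W what ->
  e * X f * Tw what = expand (fun v => c w0 *: act w0
    (foldr (sigma kappa) (foldl (fun g k => tau kappa k g) f (reduced_word simple what))
       (reduced_word simple (w0 *m v)))).
Proof.
move=> whatW; have [B BP] := boolp.choice symmetrizer_top.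
(* At a right descent the quadratic term of [expand_mulT] is $(t_j-t_j^{-1})$ times the coefficient
   at $v$, exactly what the shift in [sigma] removes. *)
have step j g v : W v -> desc j (invmx v) -> B (sigma kappa j g) v = B g (v *m s_ j).
  move=> vW nv; have [E _] := BP (sigma kappa j g); have [E' _] := BP g.
  have : expand (B (sigma kappa j g)) = expand (fun v => B g (v *m s_ j) +
      (if desc j (invmx v) then qd j *: B g v else 0) + (- qd j) *: B g v).
    rewrite -E /sigma rmorphB mulrBr -symmetrizer_X_T E' expand_mulT -[RHS]expandD; congr (_ + _).
    by rewrite -sc_expand scaleNr rmorphN mulNr -E' XZ !mulrA sc_central.
  by move/expand_inj => -> //; rewrite nv scaleNr addrK.
(* Each letter appended to [s] lowers $w_0\cdot$[wp s] and inserts its [sigma] innermost, whence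
   [foldr]. *)
have coef s g : reduced s -> B g (w0 *m wp s) = c w0 *: act w0 (foldr (sigma kappa) g s).
  elim/last_ind: s g => [|s j IH] g rs.
    by rewrite wp_nil mulmx1; have [_ ->] := BP g.
  have rr : reduced s.
    have := reduced_rev hPhi hsimple rs; rewrite rev_rcons => /(reduced_behead hPhi hsimple).
    by move/(reduced_rev hPhi hsimple); rewrite revK.
  have := reduced_rev hPhi hsimple rs; rewrite rev_rcons => /(reduced_cons_pos hPhi hsimple).
  rewrite (wp_rev hPhi hsimple) => ps.
  have wW : W (w0 *m wp s) by exact: (weyl_mul hPhi hsimple).
  rewrite wp_rcons mulmxA -step ?IH ?foldr_rcons //.
  by rewrite (positive_longest_mul hPhi hsimple hw0) // negbK.
rewrite /Tw symmetrizer_X_prod; set g := foldl _ _ _.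
have [-> _] := BP g; apply: eq_expand => v vW.
have w0vW : W (w0 *m v) by exact: (weyl_mul hPhi hsimple).
rewrite -coef ?(reduced_reduced_word hPhi hsimple) // (wp_reduced_word hPhi hsimple) //.
by rewrite mulmxA (longest_invol hPhi hsimple hw0) mul1mx.
Qed.

End Symmetrizer.

Definition Tinv j : H := T j - sc (qd j).

Lemma T_Tinv j : T j * Tinv j = 1.
Proof. by rewrite mulrBr T_sq sc_central addrAC subrr add0r. Qed.

Lemma Tinv_T j : Tinv j * T j = 1.
Proof. by rewrite mulrBl T_sq addrAC subrr add0r. Qed.

Lemma prodT_Tinv s : \prod_(k <- rev s) T k * \prod_(k <- s) Tinv k = 1.
Proof.
elim: s => [|j s IH]; first by rewrite !big_nil mulr1.
by rewrite rev_cons -cats1 big_cat big_seq1 big_cons /= mulrA -(mulrA _ (T j)) T_Tinv mulr1.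
Qed.

Lemma prodTinv_T s : \prod_(k <- s) Tinv k * \prod_(k <- rev s) T k = 1.
Proof.
elim/last_ind: s => [|s j IH]; first by rewrite !big_nil mulr1.
by rewrite rev_rcons -cats1 big_cat big_seq1 big_cons /= mulrA -(mulrA _ (Tinv j)) Tinv_T mulr1.
Qed.

Lemma Tw_inv_ex w : exists z, z * Tw w = 1 /\ Tw w * z = 1.
Proof.
exists (\prod_(k <- rev (reduced_word simple w)) Tinv k); rewrite /Tw.
by have := (prodT_Tinv (rev (reduced_word simple w)), prodTinv_T (rev (reduced_word simple w)));
  rewrite revK => -[].
Qed.

Lemma Tw_invmx w : W w -> Tw (invmx w) = \prod_(k <- rev (reduced_word simple w)) T k.
Proof.
move=> wW; have rw := reduced_reduced_word hPhi hsimple wW.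
rewrite -Tw_reduced ?(reduced_rev hPhi hsimple) //.
by rewrite (wp_rev hPhi hsimple) (wp_reduced_word hPhi hsimple).
Qed.

Lemma tw_reduced s : reduced s -> tw (wp s) = \prod_(k <- s) tj k.
Proof.
move=> rs; rewrite /Defs.tw !(big_reduced hPhi hsimple *%R t_srefl) //.
  by rewrite (wp_reduced_word hPhi hsimple).
exact: (reduced_reduced_word hPhi hsimple).
Qed.

Lemma tw_neq0 w : tw w != 0.
Proof. by rewrite /Defs.tw prodf_seq_neq0; apply/allP => j _ /=. Qed.

Lemma tw_sreflR_pos j w : W w -> positive simple (simple j *m invmx w) ->
  tw (w *m s_ j) = tw w * tj j.
Proof.
move=> wW /(reduced_rcons wW)[rs <-]; rewrite tw_reduced //.
by rewrite -cats1 big_cat big_seq1.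
Qed.

Lemma tw_sreflR_neg j w : W w -> desc j (invmx w) -> tw w = tw (w *m s_ j) * tj j.
Proof.
move=> wW nw; rewrite -tw_sreflR_pos ?(sreflRK hPhi hsimple) //; first exact: weylR.
by rewrite (positive_sreflR hPhi hsimple).
Qed.

(** At a right descent, $t(vs_j)=t(v)t_j^{-1}$ and $t_j^{-1}+(t_j-t_j^{-1})=t_j$; at an ascent,
    $t(vs_j)=t(v)t_j$. *)
Lemma plus_eigen j (e := expand (fun v => (tw v)%:A)) : e * T j = sc (tj j) * e.
Proof.
rewrite expand_mulT sc_expand; apply: eq_expand => v vW.
case: ifPn => [nv|/negPn pv]; last by rewrite addr0 tw_sreflR_pos // scalerA mulrC.
rewrite (tw_sreflR_neg vW nv) !scalerA -scalerDl; congr (_ *: _).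
by have := t_neq0 j => t0; field.
Qed.

(** The same count with $t_j$ replaced by $-t_j^{-1}$, a substitution that preserves
    $t_j-t_j^{-1}$. *)
Lemma minus_eigen j (e := expand (fun v => ((-1) ^+ len v * (tw v)^-1)%:A)) :
  e * T j = sc (- (tj j)^-1) * e.
Proof.
rewrite expand_mulT sc_expand; apply: eq_expand => v vW.
have t0 := t_neq0 j; have tv := tw_neq0 v; have tv' := tw_neq0 (v *m s_ j).
case: ifPn => [nv|/negPn pv].
  rewrite (tw_sreflR_neg vW nv) (len_sreflR_neg hPhi hsimple vW nv) exprS.
  rewrite !scalerA -scalerDl; congr (_ *: _).
  have key (a b c : F) : a != 0 -> b != 0 ->
      c / b + (a - a^-1) * (-1 * c / (b * a)) = - a^-1 * (-1 * c / (b * a)).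
    by move=> a0 b0; field; rewrite a0 b0.
  exact: key.
rewrite addr0 tw_sreflR_pos // (len_sreflR_pos hPhi hsimple) // exprS scalerA; congr (_ *: _).
have key (a b c : F) : a != 0 -> b != 0 -> -1 * c / (b * a) = - a^-1 * (c / b).
  by move=> a0 b0; field; rewrite a0 b0.
exact: key.
Qed.

Variable Twi : 'M[R]_n -> H.
Hypothesis TwiP : forall w, W w -> Twi w * Tw w = 1 /\ Tw w * Twi w = 1.

Lemma inv_uniq (x y z : H) : x * y = 1 -> y * z = 1 -> x = z.
Proof. by move=> xy yz; rewrite -[x]mulr1 -yz mulrA xy mul1r. Qed.

Lemma prodTinv_invmx w : W w -> \prod_(k <- reduced_word simple w) Tinv k = Twi (invmx w).
Proof.
move=> wW; have [_] := TwiP (weyl_inv hPhi hsimple wW); rewrite Tw_invmx //.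
exact/inv_uniq/prodTinv_T.
Qed.

Lemma prodTinv_rev w : W w -> \prod_(k <- rev (reduced_word simple w)) Tinv k = Twi w.
Proof.
move=> wW; have [_] := TwiP wW; apply: inv_uniq.
by have := prodTinv_T (rev (reduced_word simple w)); rewrite revK.
Qed.

Lemma pi_Tinv j f : pi (Tinv j) f = pi (T j) f - qd j *: f.
Proof.
apply: (addIr (qd j *: f)); rewrite subrK -[X in _ + X]mulr_algl -piX -piDl.
by rewrite subrK.
Qed.

Theorem plus_expand f what : W what ->
  expand (fun v => (tw v)%:A) * X f * Tw what =
  expand (fun v => tw w0 *: act w0 (pi (Twi (invmx (w0 *m v)) * Tw (invmx what)) f)).
Proof.
move=> whatW; rewrite (symmetrizer_expand plus_eigen) //; apply: eq_expand => v vW.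
have w0vW : W (w0 *m v) by exact: (weyl_mul hPhi hsimple).
congr (_ *: act _ _); rewrite piM -prodTinv_invmx // Tw_invmx //.
have tauE j g : tau (fun j => tj j) j g = pi (T j) g by rewrite piT.
have sigmaE j g : sigma (fun j => tj j) j g = pi (Tinv j) g by rewrite pi_Tinv /sigma tauE.
(* [foldl] applies the operator of the first letter first, so the product in the Hecke algebra runs
   over the reversed word. *)
set g := foldl _ _ _; have -> : g = pi (\prod_(k <- rev (reduced_word simple what)) T k) f.
  rewrite /g; elim: (reduced_word simple what) (f) => [|j s IH] h; first by rewrite big_nil pi1.
  by rewrite /= IH tauE rev_cons -cats1 big_cat big_seq1 piM.
move: (pi _ f) => h; elim: (reduced_word simple (w0 *m v)) => [|j s IH].
  by rewrite big_nil pi1.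
by rewrite big_cons piM /= IH sigmaE.
Qed.

(** Each letter of a reduced word of $v$ lowers the length of $w_0v$ by one. This is needed only to
    combine the signs for $\mathbf 1^-$. *)
Lemma len_longest_mul v : W v -> (len (w0 *m v) + len v)%N = len w0.
Proof.
move=> vW; rewrite -{1}(wp_reduced_word hPhi hsimple vW) /Defs.len -/(len w0).
have := reduced_reduced_word hPhi hsimple vW.
elim/last_ind: (reduced_word simple v) => [|s j IH] rs.
  by rewrite wp_nil mulmx1 addn0.
have := reduced_rev hPhi hsimple rs; rewrite rev_rcons => rr.
have ps := reduced_cons_pos hPhi hsimple rr; rewrite (wp_rev hPhi hsimple) in ps.
have := reduced_behead hPhi hsimple rr => /(reduced_rev hPhi hsimple); rewrite revK => /IH.
have wW : W (w0 *m wp s) by exact: (weyl_mul hPhi hsimple).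
rewrite size_rcons wp_rcons mulmxA addnS -addSn -!/(len _) -(len_sreflR_neg hPhi hsimple wW) //.
by rewrite (positive_longest_mul hPhi hsimple hw0) // negbK.
Qed.

Variable iota : {linear A -> A}.
Hypothesis iotaK : involutive iota.
Hypothesis iota_act : forall w f, W w -> iota (act w f) = act w (iota f).
Hypothesis iota_nab : forall j f, iota (nab j (iota f)) = f - act (s_ j) f - nab j f.

Theorem minus_expand f what : W what ->
  expand (fun v => ((-1) ^+ len v * (tw v)^-1)%:A) * X f * Tw what =
  expand (fun v => ((tw w0)^-1 * (-1) ^+ (len v + len what)) *:
    iota (act w0 (pi (Tw (w0 *m v) * Twi what) (iota f)))).
Proof.
move=> whatW; rewrite (symmetrizer_expand minus_eigen) //; apply: eq_expand => v vW.
have w0vW : W (w0 *m v) by exact: (weyl_mul hPhi hsimple).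
have piZ h a g : pi h (a *: g) = a *: pi h g.
  by rewrite -[a *: g]mulr_algl -piX -piM -sc_central piM piX mulr_algl.
have piN h g : pi h (- g) = - pi h g by rewrite -scaleN1r piZ scaleN1r.
pose kap j := - (tj j)^-1.
(* By [iota_nab], conjugation by $\iota$ replaces $\nabla_j$ by $1-s_j-\nabla_j$, which turns the
   coefficient $t_j$ of $s_j$ into $t_j^{-1}$ and yields the scalar shift in [sigma]. *)
have sigmaE j g : sigma kap j g = - iota (pi (T j) (iota g)).
  rewrite /sigma /tau /kap piT linearD !linearZ /= iota_act // iotaK iota_nab [_ *: - g]scalerN.
  have key (a b : F) (p q h : A) :
      - b *: p + (a - b) *: q - (a - b) *: h = - (a *: p + (a - b) *: (h - p - q)).
    by rewrite !scalerBr !scalerBl scaleNr; ring.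
  exact: key.
have tauE j g : tau kap j g = - iota (pi (Tinv j) (iota g)).
  rewrite pi_Tinv linearB opprB [in X in X + _]linearZ /= iotaK addrC -sigmaE.
  by rewrite /sigma subrK.
have foldlE s g : foldl (fun g k => tau kap k g) g s =
    (-1) ^+ size s *: iota (pi (\prod_(k <- rev s) Tinv k) (iota g)).
  elim: s g => [|j s IH] g; first by rewrite big_nil pi1 iotaK scale1r.
  rewrite /= IH tauE linearN /= iotaK piN linearN scalerN exprS mulN1r scaleNr.
  by rewrite rev_cons -cats1 big_cat big_seq1 piM.
have foldrE s g : foldr (sigma kap) g s =
    (-1) ^+ size s *: iota (pi (\prod_(k <- s) T k) (iota g)).
  elim: s => [|j s IH]; first by rewrite big_nil pi1 iotaK scale1r.
  rewrite /= IH sigmaE big_cons piM linearZ /= iotaK piZ linearZ /=.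
  by rewrite -scaleNr exprS mulN1r.
rewrite foldlE foldrE prodTinv_rev // -/(Tw _) -/(len _) -/(len what).
rewrite [iota (_ *: _)]linearZ /= iotaK piZ !linearZ /= !scalerA piM iota_act //.
(* The signs come from the coefficient at $w_0$, from the [sigma] along $w_0v$ and from the [tau]
   along $\hat w$; the first two combine to $(-1)^{l(v)}$. *)
congr (_ *: _); rewrite -(len_longest_mul vW) !exprD.
have key (x y z a : F) : x * x = 1 -> x * y * (x * z * a) = a * (z * y).
  by move=> xx; transitivity (x * x * (a * (z * y))); [ring | rewrite xx mul1r].
by apply: key; rewrite -expr2 sqrr_sign.
Qed.

End Demazure.

(** * The affine Hecke algebra by generators and relations *)

Lemma mul_freealgC (F : fieldType) (I : choiceType) (x : freealg F I) c :
  x * malgC c = c *: x.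
Proof.
rewrite malgM_def malgZ_def fgmulgU; apply: eq_bigr => k _ /=.
by rewrite mulm1 mulrC.
Qed.

Lemma freealg_scaleAr (F : fieldType) (I : choiceType) c (x y : freealg F I) :
  c *: (x * y) = x * (c *: y).
Proof. by rewrite -[c *: y]mul_malgC mulrA mul_freealgC scalerAl. Qed.

Section Presented.
Local Open Scope quotient_scope.
Variables (F : fieldType) (I : choiceType) (S : set (freealg F I)).
Implicit Types (x y : freealg F I) (u v : presalg S).

Definition presproj x : presalg S := \pi_(presalg S) x.

Lemma presproj_is_linear : linear presproj.
Proof.
move=> c x y; rewrite /presproj raddfD; congr (_ + _).
by rewrite -[RHS]/(presalg_scale c _) pr_scale.
Qed.

HB.instance Definition _ :=
  GRing.isLinear.Build F (freealg F I) (presalg S) *:%R presproj presproj_is_linear.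

Lemma presprojM x y : presproj (x * y) = presproj x * presproj y.
Proof. by rewrite -[RHS]/(presalg_mul _ _) pr_mul. Qed.

Lemma presproj_rel x : S x -> presproj x = 0.
Proof.
move=> Sx; rewrite -[RHS](linear0 presproj); apply/presalg_eqP.
by rewrite subr0; apply/idealP/ideal_gen.
Qed.

Lemma presalg_scaleAr c u v : c *: (u * v) = u * (c *: v).
Proof.
elim/quotW: u => x; elim/quotW: v => y; rewrite -!/(presproj _).
by rewrite -[c *: presproj y]linearZ -!presprojM -linearZ /= freealg_scaleAr.
Qed.

End Presented.

Section HeckeRelations.
Variables (R : realType) (n r : nat) (Phi : seq 'rV[R]_n).
Variables (simple : 'I_r -> 'rV[R]_n) (Lambda : zmodClosed 'cV[R]_n) (F : fieldType).
Variable t : 'rV[R]_n -> F.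
Hypothesis hPhi : irreducible_reduced_root_system Phi.
Hypothesis hsimple : is_base simple Phi.
Hypothesis hLambda : is_lattice Phi Lambda.
Hypothesis ht0 : forall a, a \in Phi -> t a != 0.
Implicit Types (w : 'M[R]_n) (j : 'I_r) (l m : lat Lambda) (a : 'rV[R]_n).
Local Notation FL := (galg F (lat Lambda)).
Local Notation s_ := (srefl simple).
Local Notation act := (@galg_act R n Lambda F).
Local Notation nab := (@nabla R n Lambda F r simple).
Local Notation x_ := (@xpow R n Lambda F).
Local Notation H := (hecke Lambda simple t).
Local Notation hT := (@hT R n Lambda F r simple t).
Local Notation hX := (@hX R n Lambda F r simple t).
Local Notation tj j := (t (simple j)).
Local Notation qd j := (tj j - (tj j)^-1).
Local Notation sc c := (hX (c%:A : FL)).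
Local Notation free := (freealg F ('I_r + lat Lambda)%type).

Let q (x : free) : H := presproj (@hecke_rel R n Lambda F r simple t) x.

Let qM x y : q (x * y) = q x * q y. Proof. exact: presprojM. Qed.
Let qD x y : q (x + y) = q x + q y. Proof. exact: raddfD. Qed.
Let qB x y : q (x - y) = q x - q y. Proof. exact: raddfB. Qed.
Let qZ c x : q (c *: x) = c *: q x. Proof. exact: linearZ. Qed.
Let q_rel x : hecke_rel simple t x -> q x = 0. Proof. exact: presproj_rel. Qed.

Let scale_mull c (u v : H) : (c *: u) * v = c *: (u * v).
Proof. exact/esym/presalg_scaleAl. Qed.

Let scale_mulr c (u v : H) : u * (c *: v) = c *: (u * v).
Proof. exact/esym/presalg_scaleAr. Qed.

HB.instance Definition _ :=
  GRing.isLinear.Build F FL H *:%R hX (linext_is_linear _).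

Let hXP c f g : hX (c *: f + g) = c *: hX f + hX g. Proof. exact: linearP. Qed.
Let hX0 : hX 0 = 0. Proof. exact: linear0. Qed.

Lemma hX_xpow l : hX (x_ l) = q (freegen F (inr l)).
Proof. exact: linextU. Qed.

Lemma hX1 : hX 1 = 1.
Proof.
transitivity (hX (x_ 0)); first by [].
have := q_rel (@rel_x0 R n Lambda F r simple t); rewrite qB => /eqP; rewrite subr_eq0 => /eqP E.
by rewrite hX_xpow E.
Qed.

Lemma hX_mul : {morph hX : f g / f * g}.
Proof.
move=> f g; move: f; elim/galg_ind => [c f1 f2 E1 E2||l]; last first.
- elim/galg_ind: g => [c g1 g2 E1 E2||m]; last first.
  + have := q_rel (@rel_xD R n Lambda F r simple t l m); rewrite qB qM => /eqP.
    rewrite subr_eq0 => /eqP E; transitivity (hX (x_ (l + m))).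
      congr hX; exact/esym/xpowD.
    apply: etrans (hX_xpow _) (etrans (esym E) _).
    exact: (congr2 (fun a b : H => a * b) (esym (hX_xpow l)) (esym (hX_xpow m))).
  + by rewrite mulr0 hX0 mulr0.
  transitivity (c *: hX (x_ l * g1) + hX (x_ l * g2)).
    by rewrite mulrDr -scalerAr; exact: hXP.
  transitivity (hX (x_ l) * (c *: hX g1 + hX g2)).
    rewrite [RHS]mulrDr scale_mulr.
    exact: (congr2 (fun a b : H => c *: a + b) E1 E2).
  exact: (congr1 (fun a : H => hX (x_ l) * a) (esym (hXP c g1 g2))).
- by rewrite mul0r hX0 mul0r.
transitivity (c *: hX (f1 * g) + hX (f2 * g)).
  by rewrite mulrDl -scalerAl; exact: hXP.
transitivity ((c *: hX f1 + hX f2) * hX g).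
  rewrite [RHS]mulrDl scale_mull.
  exact: (congr2 (fun a b : H => c *: a + b) E1 E2).
exact: (congr1 (fun a : H => a * hX g) (esym (hXP c f1 f2))).
Qed.

HB.instance Definition _ := GRing.isMonoidMorphism.Build FL H hX (conj hX1 hX_mul).

Let hXZ c f : hX (c *: f) = c *: hX f. Proof. exact: linearZ. Qed.

Lemma scE c : sc c = c *: (1 : H).
Proof. by rewrite hXZ hX1. Qed.

Lemma scale_scE c (h : H) : c *: h = sc c * h.
Proof. by rewrite scE scale_mull mul1r. Qed.

Lemma sc_central c (h : H) : sc c * h = h * sc c.
Proof. by rewrite scE scale_mull scale_mulr mul1r mulr1. Qed.

Let hXM f g : hX (f * g) = hX f * hX g. Proof. exact: hX_mul. Qed.
Let hXB f g : hX (f - g) = hX f - hX g. Proof. exact: raddfB. Qed.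

Lemma hT_sq j : hT j * hT j = sc (qd j) * hT j + 1.
Proof.
have key (K : pzRingType) (x a b : K) : a * b = 1 -> b * x = x * b ->
    (x - a) * (x + b) = 0 -> x * x = (a - b) * x + 1.
  move=> ab bx E; apply/eqP; rewrite -subr_eq0 -[X in _ == X]E mulrDr !mulrBl ab bx.
  rewrite opprD opprB [x * b - _]addrC !addrA; apply/eqP.
  by rewrite [RHS]addrAC; congr (_ - _); rewrite addrAC.
have t0 : tj j != 0 by apply: ht0; exact: base_sub hsimple j.
have qsc c : q (c%:A) = sc c by apply: etrans (qZ c 1) _; rewrite scE.
have e1 := etrans (qB (freegen F (inl j)) _) (congr1 (fun a : H => hT j - a) (qsc (tj j))).
have e2 := etrans (qD (freegen F (inl j)) _) (congr1 (fun a : H => hT j + a) (qsc (tj j)^-1)).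
have E := etrans (esym (etrans (qM _ _) (congr2 (fun a b : H => a * b) e1 e2)))
  (q_rel (@rel_quad R n Lambda F r simple t j)).
have ab : sc (tj j) * sc (tj j)^-1 = 1.
  have algV (K : lalgType F) c : c != 0 -> c%:A * c^-1%:A = 1 :> K.
    by move=> c0; rewrite mulr_algl scalerA divff // scale1r.
  exact: etrans (esym (hXM _ _)) (etrans (congr1 hX (algV FL _ t0)) hX1).
have scB : sc (qd j) = sc (tj j) - sc (tj j)^-1.
  exact: etrans (congr1 hX (scalerBl _ _ _)) (hXB _ _).
have K := key H (hT j) (sc (tj j)) (sc (tj j)^-1) ab (sc_central _ _) E.
exact: (etrans K (congr1 (fun a : H => a * hT j + 1) (esym scB))).
Qed.

Lemma alt_prodE (p : nat) i j :
  q (@alt_prod R n Lambda F r p (freegen F (inl i)) (freegen F (inl j))) =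
  \prod_(k <- alt p i j) hT k.
Proof.
elim: p i j => [|p IH] i j; first by rewrite big_nil.
by rewrite /= big_cons qM IH.
Qed.

Lemma hT_braid i j (p : nat) : i != j -> is_coxeter_exponent simple i j p ->
  \prod_(k <- alt p i j) hT k = \prod_(k <- alt p j i) hT k.
Proof.
move=> ij mC; have := q_rel (@rel_braid R n Lambda F r simple t i j p ij mC).
by rewrite qB !alt_prodE => /eqP; rewrite subr_eq0 => /eqP.
Qed.

HB.instance Definition _ j :=
  GRing.isLinear.Build F FL FL *:%R (nab j) (nabla_is_linear hPhi hsimple hLambda j).

Lemma q_linext f : q (linext (fun l => freegen F (inr l)) f) = hX f.
Proof.
move: f; apply: galg_ind => [c f g E1 E2||l].
- apply: etrans (congr1 q (linext_is_linear _ c f g)) (etrans (qD _ _) _).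
  apply: etrans (congr2 (fun a b : H => a + b) (etrans (qZ _ _) (congr1 _ E1)) E2) _.
  exact: esym (hXP _ _ _).
- by rewrite !linear0 /q linear0.
by rewrite linextU [RHS]hX_xpow.
Qed.

Let actP w c f g : act w (c *: f + g) = c *: act w f + act w g.
Proof. exact: linearP. Qed.
Let nabP' j c f g : nab j (c *: f + g) = c *: nab j f + nab j g.
Proof. exact: linearP. Qed.

(** The presentation imposes this on the basis elements $x^\lambda$ only; both sides are linear in
    [f]. *)
Lemma hT_hX j f : hT j * hX f = hX (act (s_ j) f) * hT j + hX (qd j *: nab j f).
Proof.
pose L f := hT j * hX f.
pose Rr f := hX (act (s_ j) f) * hT j + qd j *: hX (nab j f).
have LP c f1 f2 : L (c *: f1 + f2) = c *: L f1 + L f2.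
  apply: etrans (congr1 (fun a : H => hT j * a) (hXP _ _ _)) _.
  by rewrite mulrDr scale_mulr.
have RP c f1 f2 : Rr (c *: f1 + f2) = c *: Rr f1 + Rr f2.
  have E1 := etrans (congr1 hX (actP (s_ j) c f1 f2)) (hXP _ _ _).
  have E2 := etrans (congr1 hX (nabP' j c f1 f2)) (hXP _ _ _).
  apply: etrans (congr2 (fun a b : H => a * hT j + qd j *: b) E1 E2) _.
  by rewrite mulrDl scale_mull !scalerDr !scalerA addrACA (mulrC (qd j)).
have R0 (h : FL -> H) : (forall c f1 f2, h (c *: f1 + f2) = c *: h f1 + h f2) -> h 0 = 0.
  by move=> hP; have := hP (-1) 0 0; rewrite !scaleN1r !addNr.
apply: (@etrans _ _ (Rr f)); last first.
  exact: (congr1 (fun a : H => _ + a) (esym (hXZ _ _))).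
rewrite -/(L f); elim/galg_ind: f => [c f g E1 E2||l].
- by rewrite LP RP E1 E2.
- by rewrite (R0 L LP) (R0 Rr RP).
have E := q_rel (@rel_cross R n Lambda F r simple t j l).
have e1 : q (freegen F (inl j) * freegen F (inr l)) = hT j * hX (x_ l).
  exact: etrans (qM _ _) (congr1 (fun a : H => hT j * a) (esym (hX_xpow l))).
have e2 : q (freegen F (inr (lat_act (s_ j) l)) * freegen F (inl j)) =
    hX (act (s_ j) (x_ l)) * hT j.
  apply: etrans (qM _ _) (congr1 (fun a : H => a * hT j) _).
  exact: esym (etrans (congr1 hX (galg_actU _ _ _)) (hX_xpow _)).
have e3 : q ((Defs.tj simple t j - (Defs.tj simple t j)^-1) *:
    linext (fun l => freegen F (inr l)) (nab j (x_ l))) = qd j *: hX (nab j (x_ l)).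
  exact: etrans (qZ _ _) (congr1 (fun a : H => qd j *: a) (q_linext _)).
have := etrans (esym (etrans (qB _ _) (congr2 (fun a b : H => a - b)
  (etrans (qB _ _) (congr2 (fun a b : H => a - b) e1 e2)) e3))) E.
by move/eqP; rewrite -addrA -opprD subr_eq0 => /eqP.
Qed.


Hypothesis htW : forall w a, weyl Phi w -> a \in Phi -> t (dual_act w a) = t a.

Lemma t_srefl a j : a \in Phi -> t (a *m s_ j) = t a.
Proof.
move=> aP; rewrite -(htW (weyl_srefl hPhi hsimple j) aP) /dual_act.
by have := wp_rev hPhi hsimple [:: j]; rewrite wp_cons wp_nil mulmx1 => <-.
Qed.

Lemma t_simple_neq0 j : tj j != 0.
Proof. by apply: ht0; exact: base_sub hsimple j. Qed.

Lemma mcoeff_xpow l m : (x_ l)@_m = (l == m)%:R.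
Proof. exact: mcoeffU. Qed.

Lemma rdiv_nonscalar j c : rdiv simple Lambda F j != c%:A.
Proof.
apply/eqP => E; pose l := lat_of Lambda (coroot (simple j)).
have l0 : l != 0 by exact: (lat_of_coroot_neq0 hPhi hsimple hLambda).
have key (V : lmodType F) (x y : V) : x - y = c *: y -> x = (c + 1) *: y.
  by move/(canRL (subrK y)) => ->; rewrite scalerDl scale1r.
have := congr1 (fun f : FL => f@_l) (key FL (x_ l) (x_ 0) E).
rewrite mcoeffZ => E'.
have := etrans (esym (mcoeff_xpow l l)) (etrans E' (congr1 _ (mcoeff_xpow 0 l))).
by rewrite eq_refl eq_sym (negPf l0) mulr0 => /eqP; rewrite oner_eq0.
Qed.

Lemma galg_act_faithful w : weyl Phi w -> (forall f : FL, act w f = f) -> w = 1%:M.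
Proof.
move=> wW wf; apply: (weyl_faithful hPhi hsimple wW) => j.
set l := lat_of Lambda (coroot (simple j)).
have := xpow_inj (etrans (esym (galg_actU F w l)) (wf (x_ l))).
move/(congr1 val); rewrite (val_lat_act hPhi hsimple hLambda) //.
by rewrite (val_cr hsimple hLambda).
Qed.

Variable pi : H -> FL -> FL.
Hypothesis hpi : is_polynomial_rep pi.

Lemma rep_addl h1 h2 f : pi (h1 + h2) f = pi h1 f + pi h2 f.
Proof. by have := rep_linearl hpi f 1 h1 h2; rewrite !scale1r. Qed.

Lemma rep_hX g f : pi (hX g) f = g * f.
Proof.
elim/galg_ind: g => [c g1 g2 E1 E2||l]; last exact: (rep_x hpi).
  apply: etrans (congr1 (pi^~ f) (hXP c g1 g2)) _.
  apply: etrans (rep_linearl hpi f c (hX g1) (hX g2)) _.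
  apply: etrans (congr2 (fun a b : FL => c *: a + b) E1 E2) _.
  by rewrite mulrDl scalerAl.
rewrite hX0 mul0r; have := rep_linearl hpi f (-1) 0 0.
by rewrite !scaleN1r !addNr.
Qed.

Variable Ws : seq 'M[R]_n.
Hypothesis Ws_uniq : uniq Ws.
Hypothesis WsP : forall w, weyl Phi w <-> w \in Ws.

Let actL w : {linear FL -> FL} := act w.
Let nabL j : {linear FL -> FL} := nab j.
Let Xr : {rmorphism FL -> H} := hX.
Local Notation expand := (expand simple Xr hT Ws).

Lemma fsbig_weyl (V : nmodType) (G : 'M[R]_n -> V) :
  \sum_(v \in weyl Phi) G v = \sum_(v <- Ws) G v.
Proof.
have -> : weyl Phi = [set` Ws]%classic by apply/seteqP; split=> v /WsP.
by rewrite -fsbig_seq.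
Qed.

Let D j : FL := rdiv simple Lambda F j.
Let dom (f g : FL) : f * g = 0 -> f = 0 \/ g = 0. Proof. exact: galg_mul_eq0. Qed.
Let LactM w (f g : FL) : weyl Phi w -> actL w (f * g) = actL w f * actL w g.
Proof. exact: (galg_actM hPhi hsimple hLambda). Qed.
Let Lact1 w : weyl Phi w -> actL w 1 = 1.
Proof. exact: (@galg_act1 R n r Phi simple Lambda F hPhi hsimple hLambda w). Qed.
Let Lact_comp w1 w2 (f : FL) : weyl Phi w1 -> weyl Phi w2 ->
  actL (w1 *m w2) f = actL w1 (actL w2 f).
Proof. by move=> w1W w2W; exact: (galg_act_comp hPhi hsimple hLambda). Qed.
Let Lact_id (f : FL) : actL 1%:M f = f.
Proof. exact: (galg_act_id hPhi hsimple hLambda). Qed.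
Let Lact_faithful w : weyl Phi w -> (forall f : FL, actL w f = f) -> w = 1%:M.
Proof. exact: galg_act_faithful. Qed.
Let LnabP j (f : FL) : nabL j f * D j = actL (s_ j) f - f.
Proof. exact: (nablaP hPhi hsimple hLambda). Qed.
Let LT_hX j (f : FL) : hT j * Xr f = Xr (actL (s_ j) f) * hT j + Xr (qd j *: nabL j f).
Proof. exact: hT_hX. Qed.
Let LpiT j (f : FL) : pi (hT j) f = tj j *: actL (s_ j) f + qd j *: nabL j f.
Proof. exact: (rep_T hpi). Qed.

Lemma weyl_expand_inj c c' : expand c = expand c' -> forall w, weyl Phi w -> c w = c' w.
Proof.
exact: (expand_inj hPhi hsimple dom t_simple_neq0 LactM Lact1 Lact_comp Lact_id
  Lact_faithful rdiv_nonscalar LnabP hT_braid Ws_uniq WsP rep_addl (rep_one hpi)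
  (rep_mul hpi) LpiT rep_hX).
Qed.

(** [gamma] picks an arbitrary coefficient function on all matrices, and independence fixes its
    values on $W$. *)
Lemma gamma_expand c w : weyl Phi w -> gamma Phi w (expand c) = c w.
Proof.
move=> wW; rewrite /gamma; set P : set ('M[R]_n -> FL) := [set c' | _]%classic.
have Pc : P c by rewrite /P /= fsbig_weyl.
have := xgetI (fun=> 0) Pc; rewrite {1}/P /= fsbig_weyl => E.
exact: esym (weyl_expand_inj E wW).
Qed.

Lemma sum_scale_hTw (c : 'M[R]_n -> F) :
  \sum_(v \in weyl Phi) c v *: hTw Lambda simple t v = expand (fun v => (c v)%:A).
Proof. by rewrite fsbig_weyl; apply: eq_bigr => v _; rewrite scale_scE. Qed.

Lemma hinvP w : hinv (hTw Lambda simple t w) * hTw Lambda simple t w = 1 /\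
  hTw Lambda simple t w * hinv (hTw Lambda simple t w) = 1.
Proof. by have /(xgetPex 0) := Tw_inv_ex (X := Xr) sc_central hT_sq w. Qed.

Variable w0 : 'M[R]_n.
Hypothesis hw0 : is_longest simple Phi w0.

Lemma A_plusE w what f : weyl Phi w -> weyl Phi what ->
  A_plus simple t Phi w what f =
  tw simple t w0 *: act w0 (pi (hinv (hTw Lambda simple t (invmx (w0 *m w)))
                               * hTw Lambda simple t (invmx what)) f).
Proof.
move=> wW whatW.
have E := plus_expand hPhi hsimple dom t_simple_neq0 t_srefl LactM Lact1 Lact_comp Lact_id
  Lact_faithful rdiv_nonscalar LnabP sc_central hT_sq hT_braid LT_hX Ws_uniq WsP
  rep_addl (rep_one hpi) (rep_mul hpi) LpiT rep_hX hw0 (fun w _ => hinvP w) f whatW.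
have S := congr1 (fun h : H => h * hX f * hTw Lambda simple t what) 
  (sum_scale_hTw (tw simple t)).
exact: (etrans (congr1 (gamma Phi w) (etrans S E)) (gamma_expand _ wW)).
Qed.

Let Liota : {linear FL -> FL} := @iota_op R n Lambda F.
Let LiotaK : involutive Liota. Proof. exact: iotaK. Qed.
Let Liota_act w f : weyl Phi w -> Liota (actL w f) = actL w (Liota f).
Proof. exact: (iota_act hPhi hsimple hLambda). Qed.
Let Liota_nab j f : Liota (nabL j (Liota f)) = f - actL (s_ j) f - nabL j f.
Proof. exact: (iota_nabla hPhi hsimple hLambda). Qed.

Lemma A_minusE w what f : weyl Phi w -> weyl Phi what ->
  A_minus simple t Phi w what f =
  ((tw simple t w0)^-1 * (-1) ^+ (len simple w + len simple what)) *:
    iota_op (act w0 (pi (hTw Lambda simple t (w0 *m w)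
                        * hinv (hTw Lambda simple t what)) (iota_op f))).
Proof.
move=> wW whatW.
have E := minus_expand hPhi hsimple dom t_simple_neq0 t_srefl LactM Lact1 Lact_comp Lact_id
  Lact_faithful rdiv_nonscalar LnabP sc_central hT_sq hT_braid LT_hX Ws_uniq WsP
  rep_addl (rep_one hpi) (rep_mul hpi) LpiT rep_hX hw0 (fun w _ => hinvP w)
  LiotaK Liota_act Liota_nab f whatW.
have S := congr1 (fun h : H => h * hX f * hTw Lambda simple t what) 
  (sum_scale_hTw (fun v => (-1) ^+ len simple v * (tw simple t v)^-1)).
exact: (etrans (congr1 (gamma Phi w) (etrans S E)) (gamma_expand _ wW)).
Qed.

End HeckeRelations.

Theorem theorem4p6 (R : realType) (n r : nat) (Phi : seq 'rV[R]_n)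
    (simple : 'I_r -> 'rV[R]_n) (Lambda : zmodClosed 'cV[R]_n)
    (F : fieldType) (t : 'rV[R]_n -> F)
    (hPhi : irreducible_reduced_root_system Phi)
    (hsimple : is_base simple Phi)
    (hLambda : is_lattice Phi Lambda)
    (ht0 : forall a, a \in Phi -> t a != 0)
    (htW : forall w a, weyl Phi w -> a \in Phi -> t (dual_act w a) = t a)
    (pi : hecke Lambda simple t -> galg F (lat Lambda) -> galg F (lat Lambda))
    (hpi : is_polynomial_rep pi)
    (w0 : 'M[R]_n) (hw0 : is_longest simple Phi w0)
    (w what : 'M[R]_n) (hw : weyl Phi w) (hwhat : weyl Phi what) :
  (forall f : galg F (lat Lambda),
     A_plus simple t Phi w what f =
     tw simple t w0 *:
       galg_act w0
         (pi (hinv (hTw Lambda simple t (invmx (w0 *m w)))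
              * hTw Lambda simple t (invmx what)) f)) /\
  (forall f : galg F (lat Lambda),
     A_minus simple t Phi w what f =
     ((tw simple t w0)^-1 * (-1) ^+ (len simple w + len simple what)) *:
       iota_op (galg_act w0
         (pi (hTw Lambda simple t (w0 *m w)
              * hinv (hTw Lambda simple t what)) (iota_op f)))).
Proof.
have [Ws [Ws_uniq WsP]] := weyl_enum hPhi hsimple.
split=> f.
  exact: (A_plusE hPhi hsimple hLambda ht0 htW hpi Ws_uniq WsP hw0).
exact: (A_minusE hPhi hsimple hLambda ht0 htW hpi Ws_uniq WsP hw0).
Qed.
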